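(* Let $\Gamma$ be a simplicial forest. Suppose that $\mathbf{m}$ is a monomial and $i\geq 1$. Then the following are equivalent. (1) $b_{i,\mathbf{m}}(S/\mathcal{F}(\Gamma))\neq 0$. (2) $b_{i,\mathbf{m}}(S/\mathcal{F}(\Gamma))=1$. (3) The induced subcollection $\Gamma_{\mathbf{m}}$ has a well ordered facet cover of cardinality $i$. In particular, $b_{i,j}(S/\mathcal{F}(\Gamma))$ is the number of induced subcollections of $\Gamma$ which have $j$ vertices and which have well ordered facet covers of cardinality $i$.
   Context: A simplicial complex $\Gamma$ on a finite vertex set $V(\Gamma)$ is a set of subsets of $V(\Gamma)$ (called faces) such that $\{v\}\in\Gamma$ for every $v\in V(\Gamma)$ and such that every subset of a face is a face. Its facets are its inclusion-maximal faces. The simplicial complex whose facets are $F_1,\ldots,F_q$ is denoted $\langle F_1,\ldots,F_q\rangle$. A subcollection of $\Gamma$ is a simplicial complex all of whose facets are facets of $\Gamma$. A facet $F$ of $\Gamma$ is a leaf if either $F$ is the only facet of $\Gamma$, or there is a facet $G\neq F$ of $\Gamma$ such that $F\cap H\subseteq G$ for every facet $H\neq F$ of $\Gamma$. $\Gamma$ is a simplicial forest if every nonempty subcollection of $\Gamma$ has a leaf. Here $\Gamma$ has vertices $x_1,\ldots,x_n$, $\Bbbk$ is a fixed field, and $S=\Bbbk[x_1,\ldots,x_n]$. The facet ideal of $\Gamma$ is the ideal $\mathcal{F}(\Gamma)=(x_{i_1}\cdots x_{i_k} \mid \{x_{i_1},\ldots,x_{i_k}\}\text{ is a facet of }\Gamma)$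 of $S$. For a set $A$ of vertices of $\Gamma$, the induced subcollection $\Gamma_A$ is the simplicial complex $\langle F \mid F \text{ a facet of } \Gamma,\ F\subseteq A\rangle$. A squarefree monomial $x_{i_1}\cdots x_{i_k}$ is used interchangeably with the set $\{x_{i_1},\ldots,x_{i_k}\}$, so $\Gamma_{\mathbf{m}}$ denotes $\Gamma_A$ with $A$ the set of variables dividing $\mathbf{m}$. A set $D$ of facets of a simplicial complex $\Delta$ is a facet cover of $\Delta$ if every vertex of $\Delta$ belongs to some element of $D$; it is minimal if no proper subset of it is a facet cover of $\Delta$. A sequence $F_1,\ldots,F_k$ of facets of $\Delta$ is a well ordered facet cover of $\Delta$ (of cardinality $k$) if $\{F_1,\ldots,F_k\}$ is a minimal facet cover of $\Delta$ and for every facet $H\notin\{F_1,\ldots,F_k\}$ of $\Delta$ there exists $\ell\leq k-1$ such that $F_\ell\subseteq H\cup F_{\ell+1}\cup F_{\ell+2}\cup\cdots\cup F_k$. $b_{i,\mathbf{m}}(S/I)$ denotes the $i$th multigraded Betti number of $S/I$ in multidegree $\mathbf{m}$, i.e. the rank of the summand generated in multidegree $\mathbf{m}$ in homological degree $i$ of the minimal multigraded free resolution of $S/I$ (with $S$ in homological degree $0$); $b_{i,j}(S/I)$ denotes the graded Betti numbers, i.e. the sum of $b_{i,\mathbf{m}}(S/I)$ over all monomials $\mathbf{m}$ of degree $j$.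
   Formalization: Clause (3) also requires that m be the product of the vertices of Γ_m; without this (3)⇒(1) fails, e.g. for Γ=⟨x1x2, x3x4⟩, m=x1x2x3, i=1, where Γ_m=⟨x1x2⟩ has a well ordered facet cover of cardinality 1 but b_{1,m}=0. *)

(* Defs.v *)
From HB Require Import structures.
From mathcomp Require Import all_boot all_order all_algebra.
From mathcomp.multinomials Require Import mpoly.

Set Implicit Arguments.
Unset Strict Implicit.
Unset Printing Implicit Defensive.

Import GRing.Theory.
Local Open Scope ring_scope.

Section SimplicialComplexes.

Variable T : finType.
Implicit Types (D E A F G H : {set T}) (X Y fs : {set {set T}}) (s : seq {set T}).

(* The vertex set of a complex is not a separate datum: singletons of vertices
   are faces, so it is the union of the faces.  It may be smaller than T, which
   is needed for subcollections. *)
Definition simplicial_complex X : bool :=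
  [forall F in X, forall G : {set T}, (G \subset F) ==> (G \in X)].

Definition vertices X : {set T} := cover X.

Definition facets X : {set {set T}} :=
  [set F : {set T} | maxset (fun G => G \in X) F].

(* The complex <F_1, ..., F_q>; note that <> is the complex without faces. *)
Definition generated_complex fs : {set {set T}} :=
  [set G : {set T} | [exists F in fs, G \subset F]].

Definition subcollection Y X : bool :=
  simplicial_complex Y && (facets Y \subset facets X).

Definition leaf X F : bool :=
  (F \in facets X) &&
  ((facets X == [set F]) ||
   [exists G in facets X, (G != F) &&
      [forall H in facets X, (H != F) ==> (F :&: H \subset G)]]).

Definition simplicial_forest X : bool :=
  simplicial_complex X &&
  [forall Y : {set {set T}},
     subcollection Y X && (Y != set0) ==> [exists F, leaf Y F]].

Definition induced_subcollection X A : {set {set T}} :=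
  generated_complex [set F in facets X | (F : {set T}) \subset A].

Definition facet_cover X fs : bool :=
  (fs \subset facets X) && (vertices X \subset cover fs).

Definition minimal_facet_cover X fs : bool := minset (facet_cover X) fs.

(* The sequence F_1, ..., F_k is nth set0 s 0, ..., nth set0 s k.-1. *)
Definition well_ordered_facet_cover X s : bool :=
  [&& uniq s, minimal_facet_cover X [set:: s] &
   [forall H in facets X, (H \notin s) ==>
     [exists l : 'I_(size s), (l.+1 < size s)%N &&
        (nth set0 s l \subset H :|: \bigcup_(F <- drop l.+1 s) F)]]].

Definition has_well_ordered_facet_cover X (i : nat) : bool :=
  [exists t : i.-tuple {set T}, well_ordered_facet_cover X t].

End SimplicialComplexes.

Section FacetIdeals.

Variables (k : fieldType) (n : nat).

Definition mvars (m : 'X_{1..n}) : {set 'I_n} := [set v | (0 < m v)%N].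

Definition sqfree_mon (A : {set 'I_n}) : 'X_{1..n} :=
  [multinom (v \in A : nat) | v < n].

Definition facet_ideal (Gamma : {set {set 'I_n}}) (p : {mpoly k[n]}) : Prop :=
  exists c : {set 'I_n} -> {mpoly k[n]},
    p = \sum_(F in facets Gamma) c F * 'X_[sqfree_mon F].

End FacetIdeals.

Section MultigradedResolutions.

Variables (k : fieldType) (n : nat) (I : {mpoly k[n]} -> Prop).

Local Notation S := {mpoly k[n]}.

Definition homogeneous_of (m : 'X_{1..n}) (p : S) : Prop :=
  forall u, u \in msupp p -> u = m.

(* A multigraded free resolution
     ... -> F_2 -> F_1 -> F_0 -> S/I -> 0
   with F_i = S^(mfr_rank i), whose a-th basis vector has multidegree
   mfr_deg a.  Elements of F_i are row vectors and F_{i+1} -> F_i is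
   v |-> v *m mfr_diff i.  The augmentation F_0 -> S/I sends the a-th basis
   vector to the class of mfr_aug a 0. *)
Record multigraded_free_resolution := MultigradedFreeResolution {
  mfr_rank : nat -> nat;
  mfr_deg : forall i, 'I_(mfr_rank i) -> 'X_{1..n};
  mfr_diff : forall i, 'M[S]_(mfr_rank i.+1, mfr_rank i);
  mfr_aug : 'cV[S]_(mfr_rank 0);
  mfr_diff_homogeneous : forall i a b (u : 'X_{1..n}),
    u \in msupp (mfr_diff i a b) -> (u + mfr_deg b)%MM = mfr_deg a;
  mfr_aug_homogeneous : forall a, homogeneous_of (mfr_deg a) (mfr_aug a 0);
  mfr_aug_surjective : forall p : S,
    exists v : 'rV[S]_(mfr_rank 0), I (p - (v *m mfr_aug) 0 0);
  mfr_exact0 : forall v : 'rV[S]_(mfr_rank 0),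
    I ((v *m mfr_aug) 0 0) <-> exists w, v = w *m mfr_diff 0;
  mfr_exactS : forall i (v : 'rV[S]_(mfr_rank i.+1)),
    v *m mfr_diff i = 0 <-> exists w, v = w *m mfr_diff i.+1
}.

(* The image of each differential lies in (x_1, ..., x_n) times its target. *)
Definition minimal_resolution (F : multigraded_free_resolution) : Prop :=
  forall i a b, (mfr_diff F i a b)@_0%MM = 0.

Definition betti (F : multigraded_free_resolution) (i : nat) (m : 'X_{1..n})
  : nat := #|[set a : 'I_(mfr_rank F i) | mfr_deg a == m]|.

Definition graded_betti (F : multigraded_free_resolution) (i j : nat) : nat :=
  (\sum_(m : 'X_{1..n < j.+1} | mdeg m == j) betti F i m)%N.

End MultigradedResolutions.

(* Main.v *)
Require Import Defs.
From mathcomp Require Import all_boot all_order all_algebra.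
From mathcomp.multinomials Require Import mpoly.

Set Implicit Arguments.
Unset Strict Implicit.
Unset Printing Implicit Defensive.

(** The Taylor resolution of S/I, where I is generated by the monomials x^F for F
   in a family Q, has the subsets of Q as basis, a subset s being in multidegree
   the least common multiple of its members.  Tensored with k, its piece of
   multidegree m is spanned by the subsets with least common multiple m, and the
   boundary deletes the elements whose deletion does not change the least common
   multiple.  Hence the Betti numbers in multidegree m are the dimensions of the
   homology of the complex spanned by the facet covers of the subcollection
   induced on m, if m is the product of the vertices of that subcollection, and
   they vanish otherwise.

   This uses that a minimal resolution can be compared with the Taylor
   resolution.  Both are seen as complexes over k with bases filtered by
   multidegree (filtered_resolution); the comparison maps and the homotopies
   respect the filtration, hence induce a homotopy equivalence on the pieces of
   multidegree m, where the differential of a minimal resolution vanishes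
   (minimal_graded_equivalence, minimal_models, betti_models).

   The complex of covers is then simplified by collapses: a set of covers which is
   closed under supersets and under toggling a fixed facet q can be deleted without
   changing the homology (collapse_retraction, models_collapses).  Two sequences of
   collapses give the theorem.

   For a forest, take a leaf F.  It has a vertex of its own, so it belongs to every
   cover, and one is left with covering the remaining vertices by the other facets.
   Modulo F some facets become comparable; if H is contained in H' modulo F, the
   covers containing H' cancel in pairs by toggling H, and H' may be dropped.  After
   this one takes the next leaf, and so on.  In the end there is no cover left or
   exactly one, and the latter, listed in the reverse order of the choice of the
   leaves, is a well ordered facet cover (covers_collapse_forest).  So the homology
   is zero, or one-dimensional in the degree given by the size of this cover.

   Conversely, let t be a well ordered facet cover, of a forest or not.  The
   cancellation that leads from Taylor's resolution to Lyubeznik's, for an order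
   that begins with t, leaves t without neighbours among the remaining covers
   (well_ordered_isolated), so the homology in degree the size of t does not
   vanish. *)

Import GRing.Theory.

(** * Coordinate projections *)

Section CoordinateProjections.

Variable k : fieldType.
Local Open Scope ring_scope.

Definition proj_on r (P : pred 'I_r) : 'M[k]_r := diag_mx (\row_a (P a)%:R).

Lemma proj_mulE r s (P : pred 'I_r) (X : 'M[k]_(r, s)) a b :
  (proj_on P *m X) a b = if P a then X a b else 0.
Proof. by rewrite mul_diag_mx !mxE; case: (P a); rewrite ?mul1r ?mul0r. Qed.

Lemma mul_projE r s (P : pred 'I_s) (X : 'M[k]_(r, s)) a b :
  (X *m proj_on P) a b = if P b then X a b else 0.
Proof. by rewrite mul_mx_diag !mxE; case: (P b); rewrite ?mulr1 ?mulr0. Qed.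

Lemma projE r (P : pred 'I_r) a b : proj_on P a b = ((a == b) && P a)%:R.
Proof. by rewrite !mxE; case: eqVneq => //= _; case: (P b). Qed.

Lemma eq_proj r (P Q : pred 'I_r) : P =1 Q -> proj_on P = proj_on Q.
Proof. by move=> PQ; apply/matrixP=> a b; rewrite !projE PQ. Qed.

Lemma proj_proj r (P Q : pred 'I_r) : proj_on P *m proj_on Q = proj_on (predI P Q).
Proof.
apply/matrixP=> a b; rewrite proj_mulE !projE /= andbCA.
by case: (P a).
Qed.

Lemma proj_idem r (P : pred 'I_r) : proj_on P *m proj_on P = proj_on P.
Proof. by rewrite proj_proj; apply: eq_proj => a /=; rewrite andbb. Qed.

Lemma mulmx_neq0 r s t (X : 'M[k]_(r, s)) (Y : 'M[k]_(s, t)) a c :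
  (X *m Y) a c != 0 -> exists b, X a b != 0 /\ Y b c != 0.
Proof.
rewrite mxE => nz; have [b hb | all0] := pickP [pred b | X a b * Y b c != 0].
  by exists b; move: hb; rewrite /= mulf_eq0 negb_or => /andP[].
by case/eqP: nz; apply: big1 => b _; apply/eqP; move: (all0 b) => /negbFE.
Qed.

Lemma proj_convex r s t (P : pred 'I_r) (Q : pred 'I_s) (R : pred 'I_t)
    (X : 'M[k]_(r, s)) (Y : 'M[k]_(s, t)) :
  (forall a b c, P a -> R c -> X a b != 0 -> Y b c != 0 -> Q b) ->
  proj_on P *m X *m proj_on Q *m Y *m proj_on R = proj_on P *m (X *m Y) *m proj_on R.
Proof.
move=> h; apply/matrixP=> a c; rewrite !mul_projE !proj_mulE.
case: ifP => // Rc; rewrite -!mulmxA proj_mulE; case: ifP => // Pa.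
rewrite !mxE; apply: eq_bigr => b _; rewrite proj_mulE.
case: ifP => // nQ; rewrite mulr0; apply/esym/eqP.
by apply: contraFT nQ; rewrite mulf_eq0 negb_or => /andP[]; apply: h.
Qed.

Lemma proj_comm r (P : pred 'I_r) (X : 'M[k]_r) :
  (forall a b, X a b != 0 -> P a = P b) -> proj_on P *m X = X *m proj_on P.
Proof.
move=> h; apply/matrixP=> a b; rewrite mul_projE proj_mulE.
by have [->|/h->//] := eqVneq (X a b) 0; rewrite !if_same.
Qed.

End CoordinateProjections.

(** * Resolutions filtered by multidegree *)

Section FilteredResolutions.

Local Open Scope ring_scope.

Variables (k : fieldType) (n : nat).
Notation mon := 'X_{1..n}.

Definition filtered r s (dA : 'I_r -> mon) (dB : 'I_s -> mon)
    (X : 'M[k]_(r, s)) : bool :=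
  [forall a, forall b, (X a b != 0) ==> (dB b <= dA a)%MM].

Lemma filteredP r s (dA : 'I_r -> mon) (dB : 'I_s -> mon) (X : 'M[k]_(r, s)) :
  reflect (forall a b, X a b != 0 -> (dB b <= dA a)%MM) (filtered dA dB X).
Proof.
apply: (iffP forallP) => [h a b|h a].
  by move: (h a) => /forallP/(_ b)/implyP.
by apply/forallP=> b; apply/implyP; apply: h.
Qed.

Lemma filtered_mul r s t (dA : 'I_r -> mon) (dB : 'I_s -> mon)
    (dC : 'I_t -> mon) (X : 'M[k]_(r, s)) (Y : 'M[k]_(s, t)) :
  filtered dA dB X -> filtered dB dC Y -> filtered dA dC (X *m Y).
Proof.
move=> /filteredP fX /filteredP fY; apply/filteredP=> a c /mulmx_neq0[b [hX hY]].
exact: lepm_trans (fY _ _ hY) (fX _ _ hX).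
Qed.

Lemma filteredB r s (dA : 'I_r -> mon) (dB : 'I_s -> mon) (X Y : 'M[k]_(r, s)) :
  filtered dA dB X -> filtered dA dB Y -> filtered dA dB (X - Y).
Proof.
move=> /filteredP fX /filteredP fY; apply/filteredP=> a b; rewrite !mxE.
have [->|/fX//] := eqVneq (X a b) 0; have [->|/fY//] := eqVneq (Y a b) 0.
by rewrite subrr eqxx.
Qed.

Lemma filtered1 r (dA : 'I_r -> mon) : filtered dA dA 1%:M.
Proof.
apply/filteredP=> a b; rewrite mxE; case: (eqVneq a b) => [->|]; last by rewrite eqxx.
by rewrite lepm_refl.
Qed.

(** The multigraded piece of a filtered matrix is multiplicative: an index
   through which a product of filtered matrices passes between two indices of
   multidegree m has multidegree m itself. *)
Lemma graded_piece_mul r s t (dA : 'I_r -> mon) (dB : 'I_s -> mon)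
    (dC : 'I_t -> mon) (X : 'M[k]_(r, s)) (Y : 'M[k]_(s, t)) (m : mon) :
  filtered dA dB X -> filtered dB dC Y ->
  proj_on k (fun a => dA a == m) *m X *m proj_on k (fun b => dB b == m)
    *m Y *m proj_on k (fun c => dC c == m) =
  proj_on k (fun a => dA a == m) *m (X *m Y) *m proj_on k (fun c => dC c == m).
Proof.
move=> /filteredP fX /filteredP fY; apply: proj_convex => a b c.
move=> /eqP da /eqP dc /fX h1 /fY h2; rewrite da in h1; rewrite dc in h2.
apply/eqP/mnmP=> i; apply/eqP; rewrite eqn_leq.
by rewrite (mnm_lepP h1) (mnm_lepP h2).
Qed.

Section CycleCondition.

Variables (J : pred mon) (fr_rank : nat -> nat).
Variables (fr_diff : forall i, 'M[k]_(fr_rank i.+1, fr_rank i)).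
Variable (fr_aug : 'cV[k]_(fr_rank 0)).

(** The rows of X, the row a being in multidegree dA a, are cycles of the
   augmented complex; in the multidegrees where J holds the module resolved is
   zero and all elements of homological degree 0 are cycles. *)
Definition cycle_at i r (dA : 'I_r -> mon) : 'M[k]_(r, fr_rank i) -> bool :=
  match i return 'M[k]_(r, fr_rank i) -> bool with
  | 0 => fun X => [forall a, J (dA a) || ((X *m fr_aug) a 0 == 0)]
  | i'.+1 => fun X => X *m fr_diff i' == 0
  end.

End CycleCondition.

(** A multigraded free resolution over the polynomial ring, of the quotient by
   the monomial ideal of the x^u with J u, amounts to a complex of vector spaces
   over k whose bases carry multidegrees: an entry c x^(deg a - deg b) of a
   differential is replaced by c, and exactness in multidegree u becomes
   exactness of the subcomplex spanned by the basis elements of multidegree at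
   most u. *)
Record filtered_resolution (J : pred mon) := FilteredResolution {
  fr_rank : nat -> nat;
  fr_deg : forall i, 'I_(fr_rank i) -> mon;
  fr_diff : forall i, 'M[k]_(fr_rank i.+1, fr_rank i);
  fr_aug : 'cV[k]_(fr_rank 0);
  fr_diff_filtered : forall i, filtered (@fr_deg i.+1) (@fr_deg i) (fr_diff i);
  fr_diff_cycle : forall i, cycle_at J fr_diff fr_aug (@fr_deg i.+1) (fr_diff i);
  fr_aug_surjective : forall u, J u \/
    exists v : 'rV_(fr_rank 0), filtered (fun=> u) (@fr_deg 0) v /\ v *m fr_aug = 1%:M;
  fr_diff_exact : forall i u (v : 'rV_(fr_rank i)), filtered (fun=> u) (@fr_deg i) v ->
    cycle_at J fr_diff fr_aug (fun=> u) v ->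
    exists w : 'rV_(fr_rank i.+1),
      filtered (fun=> u) (@fr_deg i.+1) w /\ w *m fr_diff i = v
}.

Section Comparison.

Variable J : pred mon.
Hypothesis J_mono : forall u v, (u <= v)%MM -> J u -> J v.
Implicit Types C : filtered_resolution J.

Lemma fr_diff_diff C i : fr_diff C i.+1 *m fr_diff C i = 0.
Proof. exact/eqP/(fr_diff_cycle C i.+1). Qed.

(** The rows are lifted independently, each in its own multidegree. *)
Lemma filtered_lift C i r (dA : 'I_r -> mon) (X : 'M[k]_(r, fr_rank C i)) :
  filtered dA (@fr_deg _ C i) X -> cycle_at J (fr_diff C) (fr_aug C) dA X ->
  exists Y : 'M[k]_(r, fr_rank C i.+1),
    filtered dA (@fr_deg _ C i.+1) Y && (Y *m fr_diff C i == X).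
Proof.
move=> /filteredP fX cX.
have /fin_all_exists[Y hY] (a : 'I_r) : exists w : 'rV_(fr_rank C i.+1),
    filtered (fun=> dA a) (@fr_deg _ C i.+1) w /\ w *m fr_diff C i = row a X.
  apply: fr_diff_exact; first by apply/filteredP=> b c; rewrite mxE; apply: fX.
  case: i X cX {fX} => [|i] X /= cX.
    apply/forallP=> b; rewrite ord1 -row_mul mxE; exact: (forallP cX a).
  by rewrite -row_mul (eqP cX) row0.
exists (\matrix_a Y a); apply/andP; split.
  apply/filteredP=> a b; rewrite mxE; have [/filteredP/(_ 0 b) h _] := hY a.
  exact: h.
apply/eqP/row_matrixP=> a; rewrite row_mul rowK.
by have [] := hY a.
Qed.

Lemma augmentation_congr r s (dA : 'I_r -> mon) (dB : 'I_s -> mon)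
    (X : 'M[k]_(r, s)) (y z : 'cV[k]_s) :
  filtered dA dB X -> (forall b, J (dB b) || (y b 0 == z b 0)) ->
  forall a, J (dA a) || ((X *m y) a 0 == (X *m z) a 0).
Proof.
move=> /filteredP fX yz a; case Ja: (J (dA a)) => //=.
apply/eqP; rewrite !mxE; apply: eq_bigr => b _.
have [->|/fX ab] := eqVneq (X a b) 0; first by rewrite !mul0r.
case/orP: (yz b) => [Jb|/eqP->//].
by rewrite (J_mono ab Jb) in Ja.
Qed.

(** Dependent choice along the homological degree, constructive because the
   predicates are boolean and the types have a choice operator. *)
Lemma homological_choice (X : nat -> choiceType) (good : forall i, pred (X i))
    (R : forall i, X i -> X i.+1 -> bool) :
  (exists x, good 0 x) ->
  (forall i x, good i x -> exists y, good i.+1 y && R i x y) ->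
  exists f : forall i, X i, forall i, good i (f i) /\ R i (f i) (f i.+1).
Proof.
move=> ex0 exS.
pose G i := {x : X i | good i x}.
pose g0 : G 0 := exist _ (xchoose ex0) (xchooseP ex0).
pose next i (x : G i) := xchoose (exS i (sval x) (svalP x)).
have nextP i (x : G i) : good i.+1 (next i x) /\ R i (sval x) (next i x).
  exact/andP/(xchooseP (exS i (sval x) (svalP x))).
pose g := fix g i : G i :=
  if i is j.+1 then exist _ (next j (g j)) (proj1 (nextP j (g j))) else g0.
exists (fun i => sval (g i)) => i; split; first exact: (svalP (g i)).
exact: (proj2 (nextP i (g i))).
Qed.

Record chain_map C C' (f : forall i, 'M[k]_(fr_rank C i, fr_rank C' i)) : Prop := {
  chain_map_filtered : forall i, filtered (@fr_deg _ C i) (@fr_deg _ C' i) (f i);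
  chain_map_diff : forall i, fr_diff C i *m f i = f i.+1 *m fr_diff C' i;
  chain_map_aug : forall a, J (fr_deg a) || ((f 0 *m fr_aug C') a 0 == fr_aug C a 0)
}.

(** The usual lifting: once it is built in degree i, the map composed with the
   differential has cycles as rows, which exactness of the target lifts. *)
Lemma chain_map_exists C C' : exists f, @chain_map C C' f.
Proof.
pose good i (f : 'M[k]_(fr_rank C i, fr_rank C' i)) :=
  [&& filtered (@fr_deg _ C i) (@fr_deg _ C' i) f,
      cycle_at J (fr_diff C') (fr_aug C') (@fr_deg _ C i.+1) (fr_diff C i *m f) &
      (if i is 0 then fun f : 'M[k]_(fr_rank C 0, fr_rank C' 0) =>
         [forall a, J (@fr_deg _ C 0 a) || ((f *m fr_aug C') a 0 == fr_aug C a 0)]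
       else fun=> true) f].
pose square i (f : 'M[k]_(fr_rank C i, fr_rank C' i))
    (f' : 'M[k]_(fr_rank C i.+1, fr_rank C' i.+1))
  := f' *m fr_diff C' i == fr_diff C i *m f.
have [||f hf] := @homological_choice _ good square.
- have /fin_all_exists[Y hY] (a : 'I_(fr_rank C 0)) : exists w : 'rV_(fr_rank C' 0),
      filtered (fun=> fr_deg a) (@fr_deg _ C' 0) w /\
      (J (fr_deg a) || (w *m fr_aug C' == (fr_aug C a 0)%:M)).
    have [->|[v [fv va]]] := fr_aug_surjective C' (fr_deg a).
      by exists 0; split=> //; apply/filteredP=> b c; rewrite mxE eqxx.
    exists (fr_aug C a 0 *: v); split; last first.
      by rewrite -scalemxAl va scalemx1 eqxx orbT.
    apply/filteredP=> b c; rewrite mxE mulf_eq0 negb_or => /andP[_].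
    exact: (filteredP _ _ _ fv).
  have fY : filtered (@fr_deg _ C 0) (@fr_deg _ C' 0) (\matrix_a Y a).
    apply/filteredP=> a b; rewrite mxE; have [/filteredP/(_ 0 b) h _] := hY a.
    exact: h.
  have augY a : J (fr_deg a) || (((\matrix_a Y a) *m fr_aug C') a 0 == fr_aug C a 0).
    have [_ /orP[->//|/eqP Ya]] := hY a; apply/orP; right.
    have -> : (\matrix_a Y a *m fr_aug C') a 0 = (Y a *m fr_aug C') 0 0.
      by rewrite -[Y a](rowK Y) -row_mul [RHS]mxE.
    by rewrite Ya !mxE eqxx.
  exists (\matrix_a Y a); rewrite /good fY /=; apply/andP; split; apply/forallP => a //.
  have := augmentation_congr (fr_diff_filtered C 0) augY a.
  have := forallP (fr_diff_cycle C 0) a; case: (J _) => //= /eqP-> /eqP.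
  by rewrite -mulmxA => ->.
- move=> i f /and3P[ff cf _].
  have [f' /andP[ff' /eqP sq]] :=
    filtered_lift (filtered_mul (fr_diff_filtered C i) ff) cf.
  exists f'; rewrite /good /square ff' sq eqxx !andbT /=.
  by rewrite -mulmxA sq mulmxA fr_diff_diff mul0mx.
exists f; split=> [i|i|a].
- by have [/and3P[]] := hf i.
- by have [_ /eqP] := hf i.
- by have [/and3P[_ _ /forallP/(_ a)]] := hf 0.
Qed.

Lemma chain_map_comp C C' C'' f g :
  @chain_map C C' f -> @chain_map C' C'' g ->
  @chain_map C C'' (fun i => f i *m g i).
Proof.
move=> [fil sq au] [fil' sq' au']; split=> [i|i|a].
- exact: filtered_mul (fil i) (fil' i).
- by rewrite mulmxA sq -!mulmxA sq'.
have := augmentation_congr (fil 0) au' a; have := au a; case: (J _) => //=.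
by rewrite -mulmxA => /eqP-> /eqP->.
Qed.

(** The homotopy is lifted through the differentials in the same way.  Its
   equation in homological degree 0 has one term less and is left out. *)
Lemma chain_map_homotopic_id C f : @chain_map C C f ->
  exists h : forall i, 'M[k]_(fr_rank C i, fr_rank C i.+1),
  (forall i, filtered (@fr_deg _ C i) (@fr_deg _ C i.+1) (h i)) /\
  (forall i, f i.+1 = 1%:M + h i.+1 *m fr_diff C i.+1 + fr_diff C i *m h i).
Proof.
move=> [fil sq au].
pose good i (h : 'M[k]_(fr_rank C i, fr_rank C i.+1)) :=
  filtered (@fr_deg _ C i) (@fr_deg _ C i.+1) h &&
  cycle_at J (fr_diff C) (fr_aug C) (@fr_deg _ C i.+1) (f i.+1 - 1%:M - fr_diff C i *m h).
pose square i (h : 'M[k]_(fr_rank C i, fr_rank C i.+1))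
    (h' : 'M[k]_(fr_rank C i.+1, fr_rank C i.+2))
  := f i.+1 == 1%:M + h' *m fr_diff C i.+1 + fr_diff C i *m h.
have [||h hh] := @homological_choice _ good square.
- have [||h /andP[fh /eqP hE]] := @filtered_lift C 0 _ (@fr_deg _ C 0) (f 0 - 1%:M).
  + exact: filteredB (fil 0) (filtered1 _).
  + apply/forallP=> a; case/orP: (au a) => [->//|/eqP fa]; apply/orP; right.
    by rewrite mulmxBl mul1mx !mxE -fa !mxE subrr.
  exists h; rewrite /good fh /=.
  by rewrite !mulmxBl mul1mx -sq -mulmxA hE mulmxBr mulmx1 subrr.
- move=> i h /andP[fh ch].
  have fX := filteredB (filteredB (fil i.+1) (filtered1 _))
                       (filtered_mul (fr_diff_filtered C i) fh).
  have [h' /andP[fh' /eqP hE]] := filtered_lift fX ch.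
  exists h'; rewrite /good /square fh' hE /=.
  rewrite !mulmxBl mul1mx -sq -[_ *m h' *m _]mulmxA hE !mulmxBr mulmx1.
  by rewrite mulmxA fr_diff_diff mul0mx subr0 subrr eqxx -addrA subrK addrC subrK eqxx.
exists h; split=> i; first by have [/andP[]] := hh i.
by have [_ /eqP] := hh i.
Qed.

(** In the piece of multidegree m a resolution is homotopy equivalent to any
   other one.  The differential of a minimal resolution vanishes there, so one
   of the two homotopies does as well. *)
Lemma minimal_graded_equivalence C C' (m : mon) i :
  (forall j a b, fr_deg a = fr_deg b -> fr_diff C j a b = 0) ->
  let M j := proj_on k (fun a : 'I_(fr_rank C j) => fr_deg a == m) in
  let M' j := proj_on k (fun a : 'I_(fr_rank C' j) => fr_deg a == m) in
  exists (f : 'M_(fr_rank C i.+1, fr_rank C' i.+1))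
    (g : 'M_(fr_rank C' i.+1, fr_rank C i.+1))
    (h : 'M_(fr_rank C' i.+1, fr_rank C' i.+2)) (h' : 'M_(fr_rank C' i, fr_rank C' i.+1)),
  [/\ M i.+1 *m f *m M' i.+1 *m g *m M i.+1 = M i.+1,
      M i.+1 *m f *m M' i.+1 *m fr_diff C' i *m M' i = 0,
      M' i.+2 *m fr_diff C' i.+1 *m M' i.+1 *m g *m M i.+1 = 0 &
      M' i.+1 *m g *m M i.+1 *m f *m M' i.+1 =
      M' i.+1 + M' i.+1 *m h *m M' i.+2 *m fr_diff C' i.+1 *m M' i.+1
      + M' i.+1 *m fr_diff C' i *m M' i *m h' *m M' i.+1].
Proof.
move=> minC M M'.
have [f hf] := chain_map_exists C C'.
have [g hg] := chain_map_exists C' C.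
have [h [fh hE]] := chain_map_homotopic_id (chain_map_comp hf hg).
have [h' [fh' hE']] := chain_map_homotopic_id (chain_map_comp hg hf).
have dC j := fr_diff_filtered C j; have dC' j := fr_diff_filtered C' j.
have ff j := chain_map_filtered hf j; have fg j := chain_map_filtered hg j.
have MdM j : M j.+1 *m fr_diff C j *m M j = 0.
  apply/matrixP=> a b; rewrite mul_projE proj_mulE mxE.
  by case: eqP => // bm; case: eqP => // am; apply: minC; rewrite am bm.
have XMdM r j (X : 'M_(r, fr_rank C j.+1)) : X *m M j.+1 *m fr_diff C j *m M j = 0.
  by rewrite -[X *m _ *m _]mulmxA -mulmxA MdM mulmx0.
exists (f i.+1), (g i.+1), (h' i.+1), (h' i); split.
- rewrite graded_piece_mul // hE !mulmxDr mulmx1 !mulmxDl proj_idem.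
  rewrite -(graded_piece_mul _ (fh i.+1) (dC i.+1)).
  rewrite -(graded_piece_mul _ (dC i) (fh i)).
  by rewrite MdM XMdM !mul0mx !addr0.
- rewrite graded_piece_mul // -(chain_map_diff hf) -(graded_piece_mul _ (dC i) (ff i)).
  by rewrite MdM !mul0mx.
- rewrite graded_piece_mul // (chain_map_diff hg).
  rewrite -(graded_piece_mul _ (fg i.+2) (dC i.+1)).
  exact: XMdM.
- rewrite graded_piece_mul // hE' !mulmxDr mulmx1 !mulmxDl proj_idem.
  rewrite -(graded_piece_mul _ (fh' i.+1) (dC' i.+1)).
  by rewrite -(graded_piece_mul _ (dC' i) (fh' i)).
Qed.

End Comparison.

End FilteredResolutions.

(** * The Boolean chain complex and its collapses *)

Section WeightedMaps.

Variables (k : fieldType) (X : finType).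
Local Open Scope ring_scope.
Notation N := #|{: X}|.
Implicit Types (phi psi : X -> X) (c e : X -> k).

Definition weighted_map phi c : 'M[k]_N :=
  \matrix_(a, b) (if phi (enum_val a) == enum_val b then c (enum_val a) else 0).

Lemma weighted_map_neq0 phi c a b : weighted_map phi c a b != 0 ->
  phi (enum_val a) = enum_val b /\ c (enum_val a) != 0.
Proof. by rewrite mxE; case: ifP => [/eqP//|_]; rewrite eqxx. Qed.

Lemma eq_weighted_map phi psi c e :
  c =1 e -> (forall x, c x != 0 -> phi x = psi x) ->
  weighted_map phi c = weighted_map psi e.
Proof.
move=> ce pp; apply/matrixP=> a b; rewrite !mxE -ce.
have [->|/pp->] := eqVneq (c (enum_val a)) 0; last by [].
by rewrite !if_same.
Qed.

Lemma weighted_map_mul phi psi c e :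
  weighted_map phi c *m weighted_map psi e =
  weighted_map (psi \o phi) (fun x => c x * e (phi x)).
Proof.
apply/matrixP=> a b; rewrite mxE (bigD1 (enum_rank (phi (enum_val a)))) //=.
rewrite !mxE enum_rankK eqxx big1 ?addr0 => [|j].
  by case: eqP => // _; rewrite mulr0.
move=> ne; rewrite mxE; case: eqP => [E|_]; last by rewrite mul0r.
by rewrite E enum_valK eqxx in ne.
Qed.

Lemma weighted_mapD phi c e :
  weighted_map phi c + weighted_map phi e = weighted_map phi (fun x => c x + e x).
Proof. by apply/matrixP=> a b; rewrite !mxE; case: eqP; rewrite ?addr0. Qed.

Lemma weighted_map0 phi c : c =1 (fun=> 0) -> weighted_map phi c = 0.
Proof. by move=> c0; apply/matrixP=> a b; rewrite !mxE c0 if_same. Qed.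

Lemma weighted_map1 : weighted_map id (fun=> 1) = 1%:M.
Proof.
by apply/matrixP=> a b; rewrite !mxE (inj_eq enum_val_inj); case: eqP.
Qed.

End WeightedMaps.

Section BooleanComplex.

Variables (k : fieldType) (I : finType).
Local Open Scope ring_scope.
Notation N := #|{: {set I}}|.
Implicit Types (s t : {set I}) (x y q : I) (K L U : {set {set I}}).

(** The signs of the boundary come from a total order on I; any one would do. *)
Definition rank_lt x y := (enum_rank x < enum_rank y)%N.

Definition koszul_sign x s : k := (-1) ^+ #|[set y in s | rank_lt y x]|.

Lemma koszul_signU1 x q s : q \notin s ->
  koszul_sign x (q |: s) = (-1) ^+ rank_lt q x * koszul_sign x s.
Proof.
move=> qs; rewrite /koszul_sign -exprD; congr (_ ^+ _).
rewrite (cardsD1 q) !inE eqxx /=; congr (_ + _)%N; apply: eq_card => y.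
by rewrite !inE; case: eqVneq => //= ->; rewrite (negbTE qs).
Qed.

Lemma koszul_sign_sqr x s : koszul_sign x s * koszul_sign x s = 1.
Proof. by rewrite -expr2 sqrr_sign. Qed.

Lemma rank_lt_total x y : x != y -> rank_lt x y = ~~ rank_lt y x.
Proof.
move=> xy; rewrite /rank_lt -leqNgt [RHS]leq_eqVlt (inj_eq (@ord_inj _)).
by rewrite (inj_eq enum_rank_inj) (negbTE xy).
Qed.

Definition del x : 'M[k]_N :=
  weighted_map (fun s => s :\ x) (fun s => if x \in s then koszul_sign x s else 0).

Definition ins x : 'M[k]_N :=
  weighted_map (fun s => x |: s) (fun s => if x \in s then 0 else koszul_sign x s).

Lemma del_del x : del x *m del x = 0.
Proof.
rewrite weighted_map_mul; apply: weighted_map0 => s.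
by rewrite !inE eqxx mulr0.
Qed.

Lemma del_anticomm x y : x != y -> del x *m del y + del y *m del x = 0.
Proof.
move=> xy; rewrite !weighted_map_mul.
rewrite (eq_weighted_map (psi := (fun s => s :\ y) \o (fun s => s :\ x))
  (frefl (fun s : {set I} => _ * _))) => [|s _]; last by [].
rewrite [X in _ + X](eq_weighted_map (psi := (fun s => s :\ y) \o (fun s => s :\ x))
  (frefl (fun s : {set I} => _ * _))) => [|s _]; last first.
  by apply/setP=> z; rewrite !inE andbCA.
rewrite weighted_mapD; apply: weighted_map0 => s.
rewrite !inE xy [y == x]eq_sym xy /=.
case xs: (x \in s); last by rewrite mul0r mulr0 addr0.
case ys: (y \in s); last by rewrite mul0r mulr0 addr0.
have hx : koszul_sign y s = (-1) ^+ rank_lt x y * koszul_sign y (s :\ x).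
  by rewrite -koszul_signU1 ?setD1K // !inE eqxx.
have hy : koszul_sign x s = (-1) ^+ rank_lt y x * koszul_sign x (s :\ y).
  by rewrite -koszul_signU1 ?setD1K // !inE eqxx.
rewrite hx hy (rank_lt_total xy).
by case: (rank_lt y x); rewrite ?expr0 ?expr1 !mul1r !mulN1r mulNr mulrC ?subrr ?addNr.
Qed.

(** Deletion and insertion are the contractions and the exterior products of an
   exterior algebra; they satisfy the Clifford relations. *)
Lemma del_ins x : del x *m ins x + ins x *m del x = 1%:M.
Proof.
rewrite !weighted_map_mul -weighted_map1.
rewrite (eq_weighted_map (psi := id) (e := fun s => (x \in s)%:R)); last 2 first.
- move=> s; rewrite !inE eqxx /=; case xs: (x \in s); last by rewrite mul0r.
  rewrite -[in koszul_sign x s](setD1K xs) koszul_signU1 ?inE ?eqxx //.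
  by rewrite /rank_lt ltnn mul1r koszul_sign_sqr.
- by move=> s; case: ifP => xs /=; rewrite ?mul0r ?eqxx // setD1K.
rewrite [X in _ + X](eq_weighted_map (psi := id) (e := fun s => (x \notin s)%:R));
  last 2 first.
- move=> s; rewrite !inE eqxx /=; case xs: (x \in s); first by rewrite mul0r.
  rewrite koszul_signU1 ?xs //.
  by rewrite /rank_lt ltnn mul1r koszul_sign_sqr.
- by move=> s; case: ifP => xs /=; rewrite ?mul0r ?eqxx // setU1K ?xs.
rewrite weighted_mapD; apply: eq_weighted_map => // s.
by case: (x \in s); rewrite ?addr0 ?add0r.
Qed.

Lemma del_ins_anticomm x q : x != q -> del x *m ins q + ins q *m del x = 0.
Proof.
move=> xq; rewrite !weighted_map_mul.
rewrite [X in _ + X](eq_weighted_map (psi := (fun s => q |: s) \o (fun s => s :\ x))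
  (frefl (fun s : {set I} => _ * _))) => [|s _]; last first.
  apply/setP=> z; rewrite !inE; case: (eqVneq z q) => //= ->.
  by rewrite eq_sym xq.
rewrite weighted_mapD; apply: weighted_map0 => s.
rewrite !inE [q == x]eq_sym xq (negbTE xq) /=.
case xs: (x \in s); last by rewrite mul0r mulr0 addr0.
case qs: (q \in s); first by rewrite mul0r mulr0 addr0.
have h : koszul_sign q s = (-1) ^+ rank_lt x q * koszul_sign q (s :\ x).
  by rewrite -koszul_signU1 ?setD1K // !inE eqxx.
rewrite koszul_signU1 ?qs // h (rank_lt_total xq).
by case: (rank_lt q x); rewrite ?expr0 ?expr1 ?mul1r ?mulN1r ?mulNr ?mulrN mulrC ?subrr ?addNr.
Qed.

(** The augmented boundary of the full simplex on I. *)
Definition bd : 'M[k]_N := \sum_x del x.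

(** Inserting q contracts the complex of all sets. *)
Lemma bd_ins q : bd *m ins q + ins q *m bd = 1%:M.
Proof.
rewrite mulmx_suml mulmx_sumr -big_split /= (bigD1 q) //= del_ins.
by rewrite big1 ?addr0 // => x; apply: del_ins_anticomm.
Qed.

Lemma bd_bd : bd *m bd = 0.
Proof.
rewrite /bd; elim: (index_enum I) (index_enum_uniq I) => [|x r IH].
  by rewrite big_nil mul0mx.
move=> /= /andP[xr /IH {}IH]; rewrite big_cons mulmxDl !mulmxDr IH addr0.
rewrite del_del add0r mulmx_sumr mulmx_suml -big_split /= big_seq big1 // => y yr.
by apply: del_anticomm; apply: contraNneq xr => ->.
Qed.

Lemma bd_neq0 a b : bd a b != 0 ->
  exists2 x, x \in enum_val a & enum_val b = enum_val a :\ x.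
Proof.
rewrite /bd summxE => nz.
have [x hx | all0] := pickP [pred x | del x a b != 0].
  have [<-] := weighted_map_neq0 hx; case: ifP => [xa _|]; last by rewrite eqxx.
  by exists x.
by case/eqP: nz; apply: big1 => x _; apply/eqP; move: (all0 x) => /negbFE.
Qed.

Lemma ins_neq0 q a b : ins q a b != 0 ->
  q \notin enum_val a /\ enum_val b = q |: enum_val a.
Proof.
move=> /weighted_map_neq0[<-]; case: ifP; last by [].
by rewrite eqxx.
Qed.

Definition chains_on K : 'M[k]_N := proj_on k (fun a => enum_val a \in K).

Definition bd_on K : 'M[k]_N := chains_on K *m bd *m chains_on K.

Definition card_part i : 'M[k]_N := proj_on k (fun a => #|(enum_val a : {set I})| == i).

Lemma chains_on_subl K L : L \subset K -> chains_on L *m chains_on K = chains_on L.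
Proof.
move=> /subsetP LK; rewrite /chains_on proj_proj; apply: eq_proj => a /=.
by case La: (_ \in L) => //=; rewrite LK.
Qed.

Lemma chains_on_subr K L : L \subset K -> chains_on K *m chains_on L = chains_on L.
Proof.
move=> /subsetP LK; rewrite /chains_on proj_proj; apply: eq_proj => a /=.
by rewrite andbC; case La: (_ \in L) => //=; rewrite LK.
Qed.

(** Convexity makes the truncated boundary on K square to zero: the sets between
   two members of K are in K. *)
Definition convex K :=
  forall s t u, s \in K -> u \in K -> u \subset t -> t \subset s -> t \in K.

Lemma bd_on_bd_on K : convex K -> bd_on K *m bd_on K = 0.
Proof.
move=> cK; rewrite /bd_on !mulmxA -[_ *m chains_on K *m chains_on K]mulmxA proj_idem.
rewrite proj_convex ?bd_bd ?mulmx0 ?mul0mx // => a b c Ka Kc.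
move=> /bd_neq0[x _ ab] /bd_neq0[y _ bc]; apply: cK Ka Kc _ _.
  by rewrite bc subD1set.
by rewrite ab subD1set.
Qed.

(** U consists of pairs formed by a set without q and the same set with q, and is
   closed under supersets in K.  The chains on U are then an acyclic quotient of
   those on K, so that deleting U does not change the homology. *)
Record collapsible K U q : Prop := {
  collapsible_sub : U \subset K;
  collapsible_up : forall s t, s \in U -> t \in K -> s \subset t -> t \in U;
  collapsible_toggle : forall s, (q |: s \in U) = (s :\ q \in U)
}.

Inductive collapses K : {set {set I}} -> Prop :=
| CollapsesRefl : collapses K K
| CollapsesStep U q L : collapsible K U q -> collapses (K :\: U) L ->
    collapses K L.

Lemma convexD K U q : convex K -> collapsible K U q -> convex (K :\: U).
Proof.
move=> cK [_ up _] s t u; rewrite !inE => /andP[sU sK] /andP[uU uK] ut ts.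
have tK := cK _ _ _ sK uK ut ts; rewrite tK andbT.
by apply: contra sU => tU; apply: up tU sK ts.
Qed.

Lemma collapses_trans K L M : collapses K L -> collapses L M -> collapses K M.
Proof.
by elim=> // {}K U q {}L cU _ IH /IH; apply: CollapsesStep cU.
Qed.

(** Let H insert q in the members of U without q.  As inserting q contracts the
   full simplex, bd H + H bd is the identity modulo the chains on K \ U, and
   1 - (bd H + H bd) is a deformation retraction onto these. *)
Lemma collapse_retraction K U q : convex K -> collapsible K U q ->
  exists f H : 'M[k]_N,
  [/\ f = chains_on K - bd_on K *m H - H *m bd_on K,
      f *m chains_on (K :\: U) = f,
      chains_on (K :\: U) *m f = chains_on (K :\: U),
      f *m bd_on K = bd_on K *m f &
      f *m bd_on K = f *m bd_on (K :\: U)].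
Proof.
move=> cK [UK up toggle]; set L := K :\: U.
have LK : L \subset K by apply: subsetDl.
have EUins : chains_on U *m ins q = ins q *m chains_on U.
  apply: proj_comm => a b /ins_neq0[qa ->].
  rewrite toggle; congr (_ \in U); apply/setP=> z; rewrite !inE.
  by case: eqVneq => // ->; rewrite (negbTE qa).
have [H HE] : exists H, H = chains_on U *m ins q by eexists.
have EUH : chains_on U *m H = H by rewrite HE mulmxA proj_idem.
have HEU : H *m chains_on U = H by rewrite HE EUins -mulmxA proj_idem.
have HEK : H *m chains_on K = H by rewrite -HEU -mulmxA chains_on_subl.
have dd := bd_on_bd_on cK.
have EKd : chains_on K *m bd_on K = bd_on K by rewrite /bd_on !mulmxA proj_idem.
have dEK : bd_on K *m chains_on K = bd_on K by rewrite /bd_on -mulmxA proj_idem.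
have dEU : bd_on K *m chains_on U = bd_on U.
  rewrite /bd_on -!mulmxA chains_on_subr // !mulmxA.
  have -> : chains_on U *m bd *m chains_on U =
      chains_on U *m (chains_on K *m bd *m chains_on U).
    by rewrite !mulmxA chains_on_subl.
  apply/matrixP=> a b; rewrite [in RHS]proj_mulE; case: ifP => // aU.
  rewrite mul_projE proj_mulE; case: ifP => // bU; case: ifP => // aK.
  apply/eqP; apply: contraFT aU => /bd_neq0[x _ ab].
  by apply: up bU aK _; rewrite ab subD1set.
have contr : bd_on U *m H + H *m bd_on U = chains_on U.
  have -> : bd_on U *m H = chains_on U *m (bd *m ins q) *m chains_on U.
    by rewrite /bd_on -[_ *m H]mulmxA EUH HE EUins !mulmxA.
  have -> : H *m bd_on U = chains_on U *m (ins q *m bd) *m chains_on U.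
    by rewrite /bd_on !mulmxA HEU HE.
  by rewrite -mulmxDl -mulmxDr bd_ins mulmx1 proj_idem.
have dL : chains_on L *m bd_on K = bd_on L.
  apply/matrixP=> a b; rewrite /bd_on -!mulmxA [in LHS]mulmxA chains_on_subl //.
  rewrite !mulmxA !mul_projE !proj_mulE !inE.
  case: ifP => [bK|bK]; last by rewrite andbF.
  rewrite andbT; case: ifP => [/andP[aU aK]|_]; last by rewrite if_same.
  case: ifP => // /negbFE bU; apply/eqP; apply: contraNT aU => /bd_neq0[x _ ab].
  by apply: up bU aK _; rewrite ab subD1set.
have ELU : chains_on L *m chains_on U = 0.
  rewrite /chains_on proj_proj; apply/matrixP=> a b; rewrite projE !mxE /= !inE.
  by case: (_ \in U) => //=; rewrite !andbF.
have EKLU : chains_on K = chains_on L + chains_on U.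
  apply/matrixP=> a b; rewrite [in RHS]mxE !projE !inE.
  case: eqVneq => _ /=; last by rewrite addr0.
  case aU: (_ \in U) => /=; last by rewrite addr0.
  by rewrite (subsetP UK _ aU) add0r.
have ELH : chains_on L *m H = 0 by rewrite -EUH mulmxA ELU mul0mx.
set f := chains_on K - bd_on K *m H - H *m bd_on K.
have fEU : f *m chains_on U = 0.
  rewrite !mulmxBl chains_on_subr // -[_ *m H *m _]mulmxA HEU -[H *m _ *m _]mulmxA dEU.
  by rewrite -{1}EUH [bd_on K *m _]mulmxA dEU -addrA -opprD contr subrr.
have fEK : f *m chains_on K = f.
  by rewrite !mulmxBl proj_idem -[_ *m H *m _]mulmxA HEK -[H *m _ *m _]mulmxA dEK.
have fEL : f *m chains_on L = f.
  by rewrite -[RHS]fEK EKLU mulmxDr fEU addr0.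
exists f, H; split=> //.
- rewrite /f !mulmxBr chains_on_subl // [_ *m (bd_on K *m H)]mulmxA dL
    [_ *m (H *m _)]mulmxA ELH mul0mx subr0.
  by rewrite /bd_on -[_ *m H]mulmxA ELH mulmx0 subr0.
- rewrite /f !mulmxBl !mulmxBr EKd dEK -[H *m _ *m _]mulmxA dd mulmx0 subr0.
  by rewrite [bd_on K *m (bd_on K *m H)]mulmxA dd mul0mx subr0
    [_ *m (H *m _)]mulmxA.
- by rewrite -dL mulmxA fEL.
Qed.

End BooleanComplex.

(** * Computing homology by collapses *)

Section Models.

Variables (k : fieldType) (I : finType).
Local Open Scope ring_scope.
Notation N := #|{: {set I}}|.
Implicit Types (s t : {set I}) (x y : I) (K L U : {set {set I}}).

Local Notation chains_on := (@chains_on k I).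
Local Notation bd_on := (@bd_on k I).

(** The basis elements selected by P form a basis of the homology in degree i of
   the complex spanned by K.  This is expressed by chain maps p and q in degree i
   between the span of these elements, with zero differential, and the chains on
   K: one composition is the identity, the other one is homotopic to the identity
   of the chains of degree i.  In this form it composes with retractions. *)
Definition models r (P : pred 'I_r) K i : Prop :=
  exists (p : 'M[k]_(r, N)) (q : 'M[k]_(N, r)) (h h' : 'M[k]_N),
  [/\ p *m q = proj_on k P, proj_on k P *m p = p /\ p *m chains_on K = p,
      p *m bd_on K = 0, bd_on K *m q = 0 &
      q *m p = chains_on K *m card_part k I i + (bd_on K *m h' + h *m bd_on K)].

Lemma models_collapse r (P : pred 'I_r) K U x i :
  convex K -> collapsible K U x -> models P K i -> models P (K :\: U) i.
Proof.
move=> cK cU [p [q [h [h' [pq [Pp pK] pd dq qp]]]]].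
have [f [H [fE fL Lf fd fdL]]] := collapse_retraction k cK cU.
set L := K :\: U in fL Lf fdL *.
have LK : L \subset K by apply: subsetDl.
have Ld : chains_on L *m bd_on K = bd_on L *m chains_on L.
  have -> : bd_on L *m chains_on L = bd_on L by rewrite /bd_on -mulmxA proj_idem.
  apply/matrixP=> a b; rewrite /bd_on !mulmxA chains_on_subl // !mul_projE !proj_mulE.
  rewrite !inE; case: ifP => [bK|bK]; last by rewrite andbF.
  rewrite andbT; case: ifP => [/andP[aU aK]|_]; last by rewrite if_same.
  case: ifP => // /negbFE bU; apply/eqP; apply: contraNT aU.
  move=> /bd_neq0[y _ ab]; apply: (collapsible_up cU) bU aK _.
  by rewrite ab subD1set.
have pf : p *m f *m q = p *m q.
  rewrite fE !mulmxBr !mulmxBl pK [p *m (_ *m H)]mulmxA pd !mul0mx subr0.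
  by rewrite -mulmxA -[H *m _ *m q]mulmxA dq !mulmx0 subr0.
exists (p *m f), (chains_on L *m q).
exists (chains_on L *m h *m f), (chains_on L *m h' *m f); split.
- by rewrite mulmxA -[p *m f *m _]mulmxA fL pf.
- by rewrite mulmxA Pp -mulmxA fL.
- by rewrite -mulmxA -fdL fd mulmxA pd mul0mx.
- by rewrite [bd_on L *m _]mulmxA -Ld -mulmxA dq mulmx0.
have -> : chains_on L *m q *m (p *m f) = chains_on L *m (q *m p) *m f by rewrite !mulmxA.
rewrite qp !(mulmxDr, mulmxDl); congr (_ + (_ + _)).
- rewrite [chains_on L *m _]mulmxA chains_on_subl //.
  have -> : chains_on L *m card_part k I i = card_part k I i *m chains_on L.
    by rewrite /chains_on /card_part !proj_proj; apply: eq_proj => a; rewrite /= andbC.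
  by rewrite -mulmxA Lf.
- by rewrite [chains_on L *m _]mulmxA Ld !mulmxA.
- by rewrite [chains_on L *m _]mulmxA -[_ *m bd_on K *m f]mulmxA -fd fdL mulmxA.
Qed.

Lemma models_collapses r (P : pred 'I_r) K L i :
  convex K -> collapses K L -> models P K i -> models P L i.
Proof.
move=> cK KL; elim: KL cK => // {}K U q {}L cU _ IH cK mK.
exact: IH (convexD cK cU) (models_collapse cK cU mK).
Qed.

Lemma models_set0 r (P : pred 'I_r) i : models P set0 i -> #|P| = 0%N.
Proof.
have span0 : chains_on set0 = 0.
  by apply/matrixP=> a b; rewrite projE inE andbF mxE.
move=> [p [q [h [h' [pq [_ pK] _ _ _]]]]]; apply: eq_card0 => a.
have := pq; rewrite -pK span0 mulmx0 mul0mx => /matrixP/(_ a a).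
by rewrite projE eqxx mxE /= /in_mem /=; case: (P a) => // /eqP; rewrite eq_sym oner_eq0.
Qed.

Lemma models_set1 r (P : pred 'I_r) s i :
  models P [set s] i -> #|P| = (#|s| == i).
Proof.
have bd0 : bd_on [set s] = 0.
  apply/matrixP=> a b; rewrite mul_projE proj_mulE !inE mxE.
  case: eqP => // bs; case: eqP => // as_; apply/eqP/negPn/negP.
  move=> /bd_neq0[x]; rewrite bs as_ => xs /setP/(_ x).
  by rewrite !inE eqxx xs.
move=> [p [q [h [h' [pq _ _ _]]]]]; rewrite bd0 mul0mx mulmx0 !addr0 => qp.
pose e := enum_rank s.
have qpE a b : (q *m p) a b = [&& a == e, b == e & #|s| == i]%:R.
  rewrite qp proj_mulE projE inE -[s in _ == s](enum_rankK s) (inj_eq enum_val_inj).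
  rewrite -/e; case: eqVneq => [->|//]; rewrite eq_sym enum_rankK.
  by case: (b == e).
have PE a b : proj_on k P a b = if #|s| == i then p a e * q e b else 0.
  have -> : proj_on k P = p *m (q *m p) *m q.
    by rewrite !mulmxA pq -mulmxA pq proj_idem.
  rewrite -mulmxA mxE (bigD1 e) //= big1 ?addr0 => [|j je].
    rewrite mxE (bigD1 e) //= big1 ?addr0 => [|j je].
      by rewrite qpE !eqxx /=; case: eqP; rewrite ?mul1r ?mul0r ?mulr0.
    by rewrite qpE (negbTE je) andbF mul0r.
  rewrite [X in _ * X]mxE big1 ?mulr0 // => j' _.
  by rewrite qpE (negbTE je) mul0r.
case: eqP PE => [si|_] PE; last first.
  apply: eq_card0 => a; have := PE a a; rewrite projE eqxx /= /in_mem /=.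
  by case: (P a) => // /eqP; rewrite oner_eq0.
apply/eqP; rewrite eqn_leq; apply/andP; split.
  apply/card_le1_eqP=> a b; rewrite /in_mem /= => Pa Pb.
  have := PE a a; have := PE b b; have := PE a b; rewrite !projE !eqxx Pa Pb.
  case: eqVneq => // _ /esym/eqP; rewrite mulf_eq0 => /orP[]/eqP-> h1 h2.
    by move/eqP: h2; rewrite mul0r oner_eq0.
  by move/eqP: h1; rewrite mulr0 oner_eq0.
rewrite lt0n; apply/negP=> /eqP/card0_eq P0.
have /matrixP/(_ e e) : q *m p *m (q *m p) = 0.
  rewrite mulmxA -[q *m p *m q]mulmxA pq.
  have -> : proj_on k P = 0.
    by apply/matrixP=> a b; rewrite projE mxE [P a]P0 andbF.
  by rewrite mulmx0 mul0mx.
rewrite [RHS]mxE mxE (bigD1 e) //= big1 ?addr0 => [|j je].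
  by rewrite qpE !eqxx si eqxx mulr1 => /eqP; rewrite oner_eq0.
by rewrite qpE (negbTE je) andbF mul0r.
Qed.

(** A set which has no neighbour in L, either above or below, is a cycle and is
   not homologous to zero. *)
Lemma models_isolated r (P : pred 'I_r) L s i :
  s \in L -> #|s| = i ->
  (forall x, x \in s -> s :\ x \notin L) ->
  (forall x, x \notin s -> x |: s \notin L) ->
  models P L i -> #|P| <> 0%N.
Proof.
move=> sL si below above [p [q [h [h' [_ [Pp _] _ _ qp]]]]] P0.
pose e := enum_rank s.
have rowe b : bd_on L e b = 0.
  rewrite mul_projE proj_mulE enum_rankK sL; case: ifP => // bL.
  apply/eqP; apply: contraTT bL => /bd_neq0[x]; rewrite enum_rankK => xs ->.
  exact: below.
have cole b : bd_on L b e = 0.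
  rewrite mul_projE proj_mulE enum_rankK sL; case: ifP => // bL.
  apply/eqP; apply: contraTT bL => /bd_neq0[x]; rewrite enum_rankK => xb sE.
  by rewrite -(setD1K xb) -sE above // sE !inE eqxx.
have p0 : p = 0.
  rewrite -Pp; have -> : proj_on k P = 0; last by rewrite mul0mx.
  by apply/matrixP=> a b; rewrite projE mxE [P a](card0_eq P0) andbF.
have dh0 : (bd_on L *m h') e e = 0.
  by rewrite mxE big1 // => b _; rewrite rowe mul0r.
have hd0 : (h *m bd_on L) e e = 0.
  by rewrite mxE big1 // => b _; rewrite cole mulr0.
have /matrixP/(_ e e) := qp; rewrite p0 mulmx0 [LHS]mxE [RHS]mxE [X in _ + X]mxE.
rewrite dh0 hd0 !addr0 proj_mulE projE enum_rankK sL si !eqxx => /eqP.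
by rewrite eq_sym oner_eq0.
Qed.

End Models.

(** * Facet covers of a simplicial forest *)

Section Covers.

Variable T : finType.
Implicit Types (F G H : {set T}) (V W : {set T}).
Implicit Types (r R s Q X Y : {set {set T}}).

Lemma cover_subP s V : reflect (forall F, F \in s -> F \subset V) (cover s \subset V).
Proof. exact: bigcupsP. Qed.

Lemma sub_cover s F : F \in s -> F \subset cover s.
Proof. exact: bigcup_sup. Qed.

Lemma coverS r s : r \subset s -> cover r \subset cover s.
Proof. by move=> /subsetP rs; apply/cover_subP=> F /rs/sub_cover. Qed.

Lemma coverU1 F s : cover (F |: s) = F :|: cover s.
Proof.
apply/eqP; rewrite eqEsubset subUset sub_cover ?setU11 // coverS ?subsetUr // !andbT.
apply/cover_subP=> G /setU1P[->|/sub_cover Gs]; first exact: subsetUl.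
exact: subset_trans Gs (subsetUr _ _).
Qed.

Lemma cover_seq (t : seq {set T}) : cover [set:: t] = \bigcup_(F <- t) F.
Proof.
elim: t => [|F t IH]; first by rewrite set_nil big_nil /cover big_set0.
by rewrite set_cons coverU1 IH big_cons.
Qed.

Definition covers r R V : {set {set {set T}}} :=
  [set s : {set {set T}} | [&& r \subset s, s \subset r :|: R & V \subset cover s]].

Lemma covers_convex r R V : convex (covers r R V).
Proof.
move=> s t u; rewrite !inE => /and3P[_ sR _] /and3P[ru _ Vu] ut ts.
by rewrite (subset_trans ru ut) (subset_trans ts sR) (subset_trans Vu (coverS ut)).
Qed.

(** Toggling q does not affect the covering property of the sets satisfying P,
   in which q is redundant.  E marks the covers that earlier collapses removed. *)
Lemma cover_toggle r R V (E P : pred {set {set T}}) q :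
  q \in R -> q \notin r ->
  (forall s, P s -> q \subset cover (r :|: s :\ q)) ->
  (forall s s2, s \subset s2 -> P s -> P s2) ->
  (forall s, P (q |: s) = P (s :\ q)) ->
  (forall s, P (s :\ q) -> E (q |: s) = E (s :\ q)) ->
  let K := [set s in covers r R V | ~~ E s] in
  collapsible K [set s in K | P s] q.
Proof.
move=> qR qr qc monoP Pq Eq K; split.
- by apply/subsetP=> s; rewrite inE => /andP[].
- move=> s t; rewrite !inE => /andP[_ Ps] tK st.
  by rewrite tK (monoP _ _ st Ps).
move=> s; rewrite !inE Pq; case Ps: (P (s :\ q)); last by rewrite !andbF.
rewrite (Eq _ Ps) !andbT; congr (_ && _).
have -> : (r \subset q |: s) = (r \subset s :\ q).
  apply/idP/idP=> /subsetP rs; apply/subsetP=> x xr.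
    have := rs _ xr; rewrite !inE => /orP[/eqP xq|->]; first by rewrite -xq xr in qr.
    by rewrite andbT; apply: contraNneq qr => <-.
  by have := rs _ xr; rewrite !inE => /andP[_ ->]; rewrite orbT.
case rs: (r \subset s :\ q) => //=; congr (_ && _).
  apply/idP/idP=> /subsetP sR; apply/subsetP=> x.
    by move=> /setD1P[_ xs]; apply: sR; rewrite !inE xs orbT.
  have [->|xq] := eqVneq x q; first by rewrite !inE qR orbT.
  by move=> /setU1P[/eqP|xs]; rewrite ?(negbTE xq) //; apply: sR; rewrite !inE xq.
have /qc qs := Ps; move: qs; rewrite setDDl setUid (setUidPr rs) => qs.
apply/idP/idP=> Vs; apply: subset_trans Vs _.
  rewrite coverU1 subUset qs; apply/cover_subP=> x xs.
  have [->//|xq] := eqVneq x q; apply: sub_cover; by rewrite !inE xq.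
by apply: coverS; apply: subset_trans (subD1set _ _) (subsetUr _ _).
Qed.

(** The leaf condition on all subfamilies of R.  It passes to subfamilies, and a
   leaf remains one modulo any set of vertices, as the induction on forests
   requires. *)
Definition leafy R : Prop :=
  forall Q, Q \subset R -> Q != set0 ->
  exists2 F, F \in Q &
    Q = [set F] \/ exists2 G, G \in Q :\ F &
      forall H, H \in Q :\ F -> F :&: H \subset G.

Lemma leafyS Q R : Q \subset R -> leafy R -> leafy Q.
Proof. by move=> QR lR Q' Q'Q; apply: lR; apply: subset_trans QR. Qed.

Definition covered_later (r : {set {set T}}) (t : seq {set T}) H : Prop :=
  exists2 l, l < size t &
    nth set0 t l \subset H :|: (\bigcup_(F <- drop l.+1 t) F) :|: cover r.

(** The members of r are put in the cover once and for all, and R is considered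
   modulo the vertices that they cover. *)
Definition forest_cover r R V (t : seq {set T}) : Prop :=
  [/\ uniq t, {subset t <= R},
      V \subset cover (r :|: [set:: t]),
      forall F, F \in t -> ~~ (V \subset cover ((r :|: [set:: t]) :\ F)) &
      forall H, H \in R -> H \notin t -> covered_later r t H].

(** By induction on R.  A leaf that is not contained in the others modulo the
   covered vertices has a vertex of its own, so it is forced into every cover and
   joins r as the last set of the sequence; the sets that become comparable after
   this are removed by collapses. *)
Lemma covers_collapse_forest r R V :
  leafy R -> [disjoint r & R] -> cover R \subset V ->
  collapses (covers r R V) set0 \/
  exists2 t, forest_cover r R V t &
    collapses (covers r R V) [set r :|: [set:: t]].
Proof.
have [N] := ubnP #|R|; elim: N => // N IH in r R *; rewrite ltnS => RN lR drR RV.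
have notr q : q \in R -> q \notin r.
  by move=> qR; apply/negP=> qr; rewrite (disjointFr drR qr) in qR.
have covE r' R' : [set s in covers r' R' V | ~~ pred0 s] = covers r' R' V.
  by apply/setP=> s; rewrite !inE andbT.
(* A set already covered by r can be toggled in every cover. *)
have [q /andP[qR qW] | noW] := pickP [pred q | (q \in R) && (q \subset cover r)].
  left; apply: (CollapsesStep (U := covers r R V) (q := q)); last first.
    by rewrite setDv; apply: CollapsesRefl.
  have := @cover_toggle r R V pred0 predT q qR (notr _ qR).
  rewrite covE /=; have -> : [set s in covers r R V | predT s] = covers r R V.
    by apply/setP=> s; rewrite !inE andbT.
  apply=> // s _; apply: subset_trans qW (coverS _).
  exact: subsetUl.
(* If H is contained in H' modulo the covered vertices, the covers with H' cancel
   in pairs by toggling H. *)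
have [p /and4P[HR H'R nHH' HH'] | anti] := pickP [pred p : {set T} * {set T} |
    [&& p.1 \in R, p.2 \in R, p.1 != p.2 & p.1 \subset p.2 :|: cover r]].
  case: p HR H'R nHH' HH' => H H' /= HR H'R nHH' HH'.
  have cU : collapsible (covers r R V) [set s in covers r R V | H' \in s] H.
    have := @cover_toggle r R V pred0 (fun s => H' \in s) H HR (notr _ HR).
    rewrite covE; apply=> //.
    - move=> s H's; apply: subset_trans HH' _; rewrite -coverU1; apply: coverS.
      by rewrite subUset sub1set !inE H's [H' == H]eq_sym nHH' orbT subsetUl.
    - by move=> s t /subsetP; apply.
    - by move=> s; rewrite !inE [H' == H]eq_sym (negbTE nHH').
  have KU : covers r R V :\: [set s in covers r R V | H' \in s] =
            covers r (R :\ H') V.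
    apply/setP=> s; rewrite !inE.
    have -> : (s \subset r :|: R :\ H') = (s \subset r :|: R) && (H' \notin s).
      apply/subsetP/andP=> [sR|[/subsetP sR H's] x xs].
        split; last first.
          by apply/negP=> /sR; rewrite !inE eqxx orbF; apply/negP/notr.
        by apply/subsetP=> x /sR; rewrite !inE => /orP[->//|/andP[_ ->]]; rewrite orbT.
      have := sR _ xs; rewrite !inE => /orP[->//|->].
      by rewrite andbT (contraNneq _ H's) ?orbT // => <-.
    by case: (r \subset s); case: (s \subset _); case: (H' \in s); case: (V \subset _).
  have RH' : R :\ H' \subset R by apply: subD1set.
  have [|||||[t [ut tR Vt mt wt] ct]] := IH r (R :\ H').
  - by move: RN; rewrite (cardsD1 H') H'R.
  - exact: leafyS lR.
  - exact: disjointWr drR.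
  - exact: subset_trans (coverS RH') RV.
  - by move=> c0; left; apply: CollapsesStep cU _; rewrite KU.
  right; exists t; last by apply: CollapsesStep cU _; rewrite KU.
  split=> // [F /tR|G GR Gt]; first by rewrite inE => /andP[].
  have [->|GH'] := eqVneq G H'; last by apply: wt => //; rewrite !inE GH'.
  have trans (A : {set T}) : H :|: A :|: cover r \subset H' :|: A :|: cover r.
    rewrite -!setUA subUset subsetUr andbT.
    exact: subset_trans HH' (setUS _ (subsetUr _ _)).
  have [Ht|Ht] := boolP (H \in t); last first.
    have [|//|l lt sl] := wt H; first by rewrite !inE nHH'.
    by exists l => //; apply: subset_trans sl (trans _).
  exists (index H t); first by rewrite index_mem.
  rewrite nth_index //; apply: subset_trans HH' _.
  by rewrite -setUA setUS // subsetUr.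
(* Otherwise R is an antichain modulo the covered vertices: a leaf has a vertex
   of its own, hence lies in every cover. *)
have [R0|R0] := eqVneq R set0.
  case Vr: (V \subset cover r); last first.
    left; suff -> : covers r R V = set0 by apply: CollapsesRefl.
    apply/setP=> s; rewrite !inE R0 setU0; apply/and3P=> -[rs sr Vs].
    by rewrite (subset_trans Vs (coverS sr)) in Vr.
  right; exists [::].
    by split=> //; [rewrite set_nil setU0 | move=> H; rewrite R0 inE].
  suff -> : covers r R V = [set r :|: [set:: [::]]] by apply: CollapsesRefl.
  apply/setP=> s; rewrite !inE set_nil setU0 R0 setU0 eqEsubset.
  case rs: (r \subset s); rewrite ?andbF //= andbT.
  by rewrite (subset_trans Vr (coverS rs)) andbT.
have [F FR leafF] := lR R (subxx _) R0.
have [x xF xfree] : exists2 x, x \in F :\: cover r &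
    forall H, H \in R -> H != F -> x \notin H.
  case: leafF => [RF|[G]].
    have /subsetPn[x xF xr] : ~~ (F \subset cover r).
      by have := noW F; rewrite /= FR => /negbT.
    exists x; first by rewrite inE xr.
    by move=> H; rewrite RF inE => ->.
  rewrite !inE => /andP[GF GR] sepF.
  have /subsetPn[x xF] : ~~ (F \subset G :|: cover r).
    by have := anti (F, G); rewrite /= FR GR eq_sym GF => /negbT.
  rewrite inE negb_or => /andP[xG xr].
  exists x => [|H HR HF]; first by rewrite inE xr.
  apply: contra xG => xH; have /sepF/subsetP/(_ x) : H \in R :\ F by rewrite !inE HF.
  by apply; rewrite inE xF.
move: xF; rewrite inE => /andP[xr xF].
have xV : x \in V by apply: (subsetP RV); apply/bigcupP; exists F.
have FinK s : s \in covers r R V -> F \in s.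
  rewrite inE => /and3P[rs sR /subsetP/(_ x xV)/bigcupP[H Hs xH]].
  have := subsetP sR _ Hs; rewrite inE => /orP[Hr|HR].
    by case/negP: xr; apply/bigcupP; exists H.
  have [<-//|HF] := eqVneq H F.
  by have := xfree _ HR HF; rewrite xH.
have KE : covers r R V = covers (F |: r) (R :\ F) V.
  have FRE : (F |: r) :|: R :\ F = r :|: R.
    apply/setP=> G; rewrite !inE; case: (eqVneq G F) => [->|] //=.
    by rewrite FR orbT.
  apply/setP=> s; apply/idP/idP => [sK|].
    have Fs := FinK _ sK; move: sK; rewrite !inE FRE subUset sub1set Fs.
    by case/and3P=> -> -> ->.
  by rewrite !inE FRE subUset => /and3P[/andP[_ ->] -> ->].
have RF : R :\ F \subset R by apply: subD1set.
have [|||||[t [ut tR Vt mt wt] ct]] := IH (F |: r) (R :\ F).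
- by move: RN; rewrite (cardsD1 F) FR.
- exact: leafyS lR.
- rewrite -setI_eq0; apply/eqP/setP=> G; rewrite !inE.
  case: (eqVneq G F) => //= _; apply/negP=> /andP[Gr GR].
  by rewrite (negbTE (notr _ GR)) in Gr.
- exact: subset_trans (coverS RF) RV.
- by move=> c0; left; rewrite KE.
have Ft : F \notin t by apply/negP=> /tR; rewrite !inE eqxx.
have setE : r :|: [set:: rcons t F] = (F |: r) :|: [set:: t].
  by apply/setP=> G; rewrite !inE mem_rcons inE orbCA orbA.
right; exists (rcons t F); last by rewrite KE setE.
split.
- by rewrite rcons_uniq Ft.
- by move=> G; rewrite mem_rcons inE => /orP[/eqP->//|/tR]; rewrite inE => /andP[].
- by rewrite setE.
- move=> G; rewrite mem_rcons inE setE => /orP[/eqP->|/mt//].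
  apply/subsetPn; exists x => //; apply/bigcupP=> -[H].
  rewrite !inE => /andP[HF]; rewrite (negbTE HF) /= => /orP[Hr|Ht] xH.
    by case/negP: xr; apply/bigcupP; exists H.
  by have := xfree H; rewrite xH HF (subsetP RF _ (tR _ Ht)) => /(_ isT isT).
move=> H HR; rewrite mem_rcons inE negb_or => /andP[HF Ht].
have [|//|l lt sl] := wt H; first by rewrite !inE HF.
exists l; first by rewrite size_rcons ltnW.
rewrite nth_rcons lt drop_rcons // -cats1 big_cat big_seq1 /=.
by move: sl; rewrite coverU1 !setUA.
Qed.

End Covers.

Section ForestCovers.

Variable T : finType.
Implicit Types (F G H : {set T}) (V W : {set T}).
Implicit Types (s Q X Y : {set {set T}}) (t : seq {set T}).

Definition antichain Q : Prop :=
  forall F G, F \in Q -> G \in Q -> F \subset G -> F = G.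

Lemma antichainS Q X : Q \subset X -> antichain X -> antichain Q.
Proof. by move=> /subsetP QX aX F G /QX FX /QX GX; apply: aX. Qed.

Lemma facets_antichain X : antichain (facets X).
Proof.
move=> F G; rewrite !inE => /maxsetP[_ maxF] /maxsetP[GX _] FG.
by rewrite (maxF _ GX FG).
Qed.

Lemma facets_generated Q : antichain Q -> facets (generated_complex Q) = Q.
Proof.
move=> aQ; apply/setP=> F; rewrite inE; apply/maxsetP/idP=> [[]|FQ].
  rewrite inE => /existsP[G /andP[GQ FG]] maxF.
  rewrite -(maxF G _ FG) // inE; apply/existsP; exists G.
  by rewrite GQ subxx.
split=> [|G]; first by rewrite inE; apply/existsP; exists F; rewrite FQ subxx.
rewrite inE => /existsP[H /andP[HQ GH]] FG.
have FH := aQ _ _ FQ HQ (subset_trans FG GH).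
by apply/eqP; rewrite eqEsubset FG andbT FH.
Qed.

Lemma vertices_generated Q : vertices (generated_complex Q) = cover Q.
Proof.
apply/eqP; rewrite eqEsubset; apply/andP; split; apply/cover_subP=> F.
  rewrite inE => /existsP[G /andP[GQ FG]].
  exact: subset_trans FG (sub_cover GQ).
by move=> FQ; apply: sub_cover; rewrite inE; apply/existsP; exists F; rewrite FQ subxx.
Qed.

Lemma simplicial_generated Q : simplicial_complex (generated_complex Q).
Proof.
apply/forallP=> F; apply/implyP; rewrite inE => /existsP[G /andP[GQ FG]].
apply/forallP=> H; apply/implyP=> HF; rewrite inE; apply/existsP; exists G.
by rewrite GQ (subset_trans HF FG).
Qed.

(** The subfamilies of facets are the facet sets of the subcollections. *)
Lemma forest_leafy X : simplicial_forest X -> leafy (facets X).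
Proof.
move=> /andP[_ /forallP leafX] Q QX Q0.
have aQ := antichainS QX (@facets_antichain X).
have /implyP := leafX (generated_complex Q).
rewrite /subcollection simplicial_generated (facets_generated aQ) QX /=.
have [F FQ] := set0Pn _ Q0.
have -> : generated_complex Q != set0.
  by apply/set0Pn; exists F; rewrite inE; apply/existsP; exists F; rewrite FQ subxx.
case/(_ isT)/existsP=> {FQ}F; rewrite /leaf (facets_generated aQ) => /andP[FQ hF].
exists F => //; case/orP: hF => [/eqP->|/existsP[G /and3P[GQ GF /forallP hG]]].
  by left.
right; exists G; first by rewrite !inE GF.
by move=> H; rewrite !inE => /andP[HF HQ]; move: (hG H); rewrite HQ HF.
Qed.

Lemma covers_collapse_well_ordered Q : leafy Q -> antichain Q ->
  collapses (covers set0 Q (cover Q)) set0 \/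
  exists2 t, well_ordered_facet_cover (generated_complex Q) t &
    collapses (covers set0 Q (cover Q)) [set [set:: t]].
Proof.
move=> lQ aQ.
have [||c0|[t [ut tQ Vt mt wt] ct]] :=
    @covers_collapse_forest _ set0 Q (cover Q) lQ; first 3 last.
- right; exists t; last by move: ct; rewrite set0U.
  apply/and3P; split=> //.
    apply/minsetP; split.
      rewrite /facet_cover facets_generated // vertices_generated.
      move: Vt; rewrite set0U => ->; rewrite andbT.
      by apply/subsetP=> F; rewrite inE => /tQ.
    move=> s /andP[_]; rewrite vertices_generated => Vs st.
    apply/eqP; rewrite eqEsubset st; apply/subsetP=> F; rewrite inE => Ft.
    apply: contraTT Vs => Fs; apply: contra (mt _ Ft) => Vs.
    rewrite set0U; apply: subset_trans Vs (coverS _); apply/subsetP=> G Gs.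
    by rewrite in_setD1 (subsetP st) // andbT; apply: contraNneq Fs => <-.
  apply/forallP=> H; apply/implyP; rewrite facets_generated // => HQ.
  apply/implyP=> Ht; have [l lt] := wt H HQ Ht.
  rewrite {1}/cover big_set0 setU0 => sl; apply/existsP; exists (Ordinal lt) => /=.
  rewrite sl andbT ltn_neqAle lt andbT.
  (* The last set of the cover is not contained in H, by incomparability. *)
  apply: contraNneq Ht => lE; rewrite -(aQ _ _ _ HQ (_ : nth set0 t l \subset H)).
  + exact: mem_nth.
  + by apply: tQ; apply: mem_nth.
  + by move: sl; rewrite lE drop_size big_nil setU0.
- by rewrite -setI_eq0 set0I.
- exact: subxx.
- by left.
Qed.

(** This is the cancellation behind Lyubeznik's resolution.  The l-th set F_l of t
   is redundant in s when the members of s other than F_0, ..., F_l cover it, and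
   the covers with a redundant F_l cancel in pairs by toggling F_l.  A minimal
   cover has no redundant set, so t survives; adding any H to it makes redundant
   the set that the well ordering provides for H. *)
Lemma well_ordered_isolated Q t : antichain Q ->
  well_ordered_facet_cover (generated_complex Q) t ->
  exists2 L, collapses (covers set0 Q (cover Q)) L &
  [/\ [set:: t] \in L, forall F, F \in t -> [set:: t] :\ F \notin L &
      forall H, H \notin t -> H |: [set:: t] \notin L].
Proof.
move=> aQ /and3P[ut /minsetP[]].
rewrite /facet_cover facets_generated // vertices_generated => /andP[tQ Vt] mint wo.
pose P l (s : {set {set T}}) := nth set0 t l \subset cover (s :\: [set:: take l.+1 t]).
pose E j s := has (fun l => P l s) (iota 0 j).
pose K j := [set s in covers set0 Q (cover Q) | ~~ E j s].
have tin F : F \in t -> F \in Q by move=> Ft; apply: (subsetP tQ); rewrite inE.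
have not_redundant l : l < size t -> ~~ P l [set:: t].
  move=> lt; have Ft : nth set0 t l \in t by apply: mem_nth.
  apply/negP=> Pl; suff /mint/(_ (subD1set _ _))/setP/(_ (nth set0 t l)) :
      ([set:: t] :\ nth set0 t l \subset Q) &&
      (cover Q \subset cover ([set:: t] :\ nth set0 t l)).
    by rewrite !inE eqxx Ft.
  rewrite (subset_trans (subD1set _ _) tQ) /=; apply: subset_trans Vt _.
  apply/cover_subP=> G Gt; have [->|GF] := eqVneq G (nth set0 t l).
    apply: subset_trans Pl (coverS (setDS _ _)); rewrite sub1set inE.
    by rewrite (take_nth set0) // mem_rcons inE eqxx.
  by apply: sub_cover; rewrite in_setD1 GF.
have KC j : j <= size t -> collapses (covers set0 Q (cover Q)) (K j).
  elim: j => [_|j IH jt].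
    suff -> : K 0 = covers set0 Q (cover Q) by apply: CollapsesRefl.
    by apply/setP=> s; rewrite !inE andbT.
  apply: collapses_trans (IH (ltnW jt)) _.
  have qt : nth set0 t j \in take j.+1 t.
    by rewrite (take_nth set0) // mem_rcons inE eqxx.
  have take_sub l : l < j -> [set:: take l.+1 t] \subset [set:: take j.+1 t].
    move=> lj; apply/subsetP=> F; rewrite !inE -[take l.+1 t](@take_takel _ _ j.+1).
      by move/mem_take.
    exact: ltnW.
  have cU : collapsible (K j) [set s in K j | P j s] (nth set0 t j).
    apply: cover_toggle; first exact/tin/mem_nth.
    - by rewrite inE.
    - move=> s Ps; apply: subset_trans Ps (coverS _); rewrite set0U.
      by apply: setDS; rewrite sub1set inE.
    - by move=> s s2 ss2 Ps; apply: subset_trans Ps (coverS (setSD _ ss2)).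
    - move=> s; congr (_ \subset cover _); apply/setP=> F; rewrite !inE.
      by case: (eqVneq F (nth set0 t j)) => [->|//]; rewrite qt.
    move=> s Pj; apply: eq_in_has => l; rewrite mem_iota add0n => lj.
    apply/idP/idP=> Pl; apply: subset_trans Pl _; last first.
      apply: coverS; apply: setSD; apply: subset_trans (subD1set _ _) (subsetUr _ _).
    apply/cover_subP=> G; rewrite !inE => /andP[Gl /orP[/eqP->|Gs]].
      exact: subset_trans Pj (coverS (setDS _ (take_sub _ lj))).
    have [->|Gj] := eqVneq G (nth set0 t j).
      exact: subset_trans Pj (coverS (setDS _ (take_sub _ lj))).
    by apply: sub_cover; rewrite !inE Gl Gj.
  apply: CollapsesStep cU _.
  suff -> : K j :\: [set s in K j | P j s] = K j.+1 by apply: CollapsesRefl.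
  apply/setP=> s; rewrite in_setD !in_set /E -addn1 iotaD has_cat /= orbF add0n.
  by case: [&& set0 \subset s, s \subset set0 :|: Q & cover Q \subset cover s];
    case: (P j s); case: (has _ _).
exists (K (size t)); first exact: KC.
split.
- rewrite !inE sub0set set0U tQ Vt /=; apply/hasPn=> l.
  by rewrite mem_iota => /not_redundant.
- move=> F Ft; rewrite !inE sub0set set0U /=.
  apply/negP=> /andP[/andP[FQ FV] _].
  have /mint/(_ (subD1set _ _))/setP/(_ F) :
    ([set:: t] :\ F \subset Q) && (cover Q \subset cover ([set:: t] :\ F)).
    by rewrite FQ.
  by rewrite !inE eqxx Ft.
move=> H Ht; rewrite !inE sub0set set0U /= negb_and negbK.
have [HQ|HQ] := boolP (H \in Q); last by rewrite subUset sub1set (negbTE HQ).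
apply/orP; right; have /implyP := forallP wo H.
move=> /(_ HQ)/implyP/(_ Ht)/existsP[l /andP[_ sl]].
apply/hasP; exists (nat_of_ord l); first by rewrite mem_iota ltn_ord.
apply: subset_trans sl _; rewrite -cover_seq -coverU1; apply: coverS.
apply/subsetP=> F; rewrite !inE => /orP[/eqP->|Fd].
  by rewrite eqxx andbT; apply: contra Ht; apply: mem_take.
rewrite (mem_drop Fd) orbT andbT; move: ut; rewrite -[X in uniq X](cat_take_drop l.+1 t).
by rewrite cat_uniq => /and3P[_ /hasPn/(_ _ Fd)].
Qed.

End ForestCovers.

(** * The Taylor resolution *)

Section Transfer.

Variables (k : fieldType) (I : finType).
Local Open Scope ring_scope.
Notation N := #|{: {set I}}|.
Implicit Types K : {set {set I}}.

Lemma bd_on_incl K r r' (M1 : 'M[k]_r) (M0 : 'M[k]_r') (J1 : 'M[k]_(r, N))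
    (J0 : 'M[k]_(r', N)) (d : 'M[k]_(r, r')) :
  M1 *m J1 = J1 *m chains_on k K -> M0 *m J0 = J0 *m chains_on k K ->
  J1 *m bd k I = d *m J0 ->
  J1 *m bd_on k K = M1 *m d *m M0 *m J0.
Proof.
move=> h1 h0 hd; rewrite /bd_on !mulmxA -h1 -[M1 *m J1 *m _]mulmxA hd.
by rewrite -[RHS]mulmxA h0 !mulmxA.
Qed.

Lemma bd_on_incl_tr K r r' (M1 : 'M[k]_r) (M0 : 'M[k]_r') (J1 : 'M[k]_(N, r))
    (J0 : 'M[k]_(N, r')) (E : 'M[k]_N) (d : 'M[k]_(r, r')) :
  J1 *m M1 = chains_on k K *m J1 -> J0 *m M0 = chains_on k K *m J0 ->
  chains_on k K *m E = chains_on k K -> E *m bd k I *m J0 = J1 *m d ->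
  bd_on k K *m J0 = J1 *m M1 *m d *m M0.
Proof.
move=> h1 h0 hE hd; rewrite /bd_on -[_ *m J0]mulmxA -h0 -hE h1 -!mulmxA.
by congr (_ *m _); rewrite !mulmxA hd.
Qed.

(** The data of an equivalence with a resolution T, in the multidegree selected by
   the projections M_j, move to the chains on K along the inclusions J_j of the
   bases of T. *)
Lemma models_transfer r r0 r1 r2 (P : pred 'I_r) K i
    (f : 'M[k]_(r, r1)) (M1 : 'M[k]_r1) (g : 'M[k]_(r1, r))
    (d0 : 'M[k]_(r1, r0)) (M0 : 'M[k]_r0) (M2 : 'M[k]_r2) (d1 : 'M[k]_(r2, r1))
    (h : 'M[k]_(r1, r2)) (h' : 'M[k]_(r0, r1)) (J0 : 'M[k]_(r0, N))
    (J1 : 'M[k]_(r1, N)) (J2 : 'M[k]_(r2, N)) :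
  let M := proj_on k P in
  M *m f *m M1 *m g *m M = M ->
  M *m f *m M1 *m d0 *m M0 = 0 ->
  M2 *m d1 *m M1 *m g *m M = 0 ->
  M1 *m g *m M *m f *m M1 =
    M1 + M1 *m h *m M2 *m d1 *m M1 + M1 *m d0 *m M0 *m h' *m M1 ->
  J1 *m bd_on k K = M1 *m d0 *m M0 *m J0 ->
  J2 *m bd_on k K = M2 *m d1 *m M1 *m J1 ->
  bd_on k K *m J1^T = J2^T *m M2 *m d1 *m M1 ->
  bd_on k K *m J0^T = J1^T *m M1 *m d0 *m M0 ->
  M1 *m J1 = J1 *m chains_on k K ->
  J1^T *m M1 *m J1 = chains_on k K *m card_part k I i ->
  J1 *m J1^T = 1%:M ->
  M1 *m M1 = M1 ->
  M *m M = M ->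
  models k P K i.
Proof.
move=> M G1 G2 G3 G4 up1 up2 down1 down0 M1J cells JJ M1M1 MM.
exists (M *m f *m M1 *m J1), (J1^T *m M1 *m g *m M).
exists (J1^T *m M1 *m h *m J2), (J0^T *m h' *m M1 *m J1); split.
- have -> : M *m f *m M1 *m J1 *m (J1^T *m M1 *m g *m M) =
      M *m f *m (M1 *m (J1 *m J1^T) *m M1) *m g *m M by rewrite !mulmxA.
  by rewrite JJ mulmx1 M1M1 G1.
- by split; [rewrite !mulmxA MM | rewrite -mulmxA -M1J !mulmxA -[_ *m M1 *m M1]mulmxA M1M1].
- rewrite -mulmxA up1 !mulmxA -[_ *m M1 *m M1]mulmxA M1M1.
  by rewrite G2 mul0mx.
- have -> : bd_on k K *m (J1^T *m M1 *m g *m M) = bd_on k K *m J1^T *m M1 *m g *m M.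
    by rewrite !mulmxA.
  rewrite down1 -[_ *m M1 *m M1]mulmxA M1M1.
  have -> : J2^T *m M2 *m d1 *m M1 *m g *m M = J2^T *m (M2 *m d1 *m M1 *m g *m M).
    by rewrite !mulmxA.
  by rewrite G3 mulmx0.
have -> : J1^T *m M1 *m g *m M *m (M *m f *m M1 *m J1) =
    J1^T *m (M1 *m g *m (M *m M) *m f *m M1) *m J1 by rewrite !mulmxA.
rewrite MM G4 !(mulmxDr, mulmxDl) cells -addrA; congr (_ + _).
rewrite addrC; congr (_ + _).
  by rewrite !mulmxA down0.
by rewrite -[RHS]mulmxA up2 !mulmxA.
Qed.

End Transfer.

Section Taylor.

Variables (k : fieldType) (n : nat) (Q : {set {set 'I_n}}).
Local Open Scope ring_scope.
Notation mon := 'X_{1..n}.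
Notation N := #|{: {set {set 'I_n}}}|.
Implicit Types (s : {set {set 'I_n}}) (F : {set 'I_n}) (u m : mon).

Local Notation bd := (bd k {set 'I_n}).

Definition monomial_in u : bool := [exists F in Q, (sqfree_mon F <= u)%MM].

Lemma monomial_in_mono u v : (u <= v)%MM -> monomial_in u -> monomial_in v.
Proof.
move=> uv /existsP[F /andP[FQ Fu]]; apply/existsP; exists F.
by rewrite FQ (lepm_trans Fu uv).
Qed.

Lemma sqfree_monP F u :
  reflect (forall v, v \in F -> (0 < u v)%N) (sqfree_mon F <= u)%MM.
Proof.
apply: (iffP mnm_lepP) => [h v vF|h v]; first by have := h v; rewrite mnmE vF.
by rewrite mnmE; case vF: (v \in F); rewrite // h.
Qed.

Lemma sqfree_mon_cover s u :
  reflect (forall F, F \in s -> (sqfree_mon F <= u)%MM)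
          (sqfree_mon (cover s) <= u)%MM.
Proof.
apply: (iffP (sqfree_monP _ _)) => [h F Fs|h v].
  by apply/sqfree_monP=> v vF; apply: h; apply/bigcupP; exists F.
by case/bigcupP=> F /h/sqfree_monP; apply.
Qed.

Definition taylor_cells i : {set {set {set 'I_n}}} :=
  [set s : {set {set 'I_n}} | (s \subset Q) && (#|s| == i)].

Definition incl i : 'M[k]_(#|taylor_cells i|, N) :=
  \matrix_(a, b) (enum_val a == enum_val b)%:R.

Lemma incl_mulE i r (X : 'M[k]_(N, r)) a b :
  (incl i *m X) a b = X (enum_rank (enum_val a)) b.
Proof.
rewrite mxE (bigD1 (enum_rank (enum_val a))) //= mxE enum_rankK eqxx mul1r.
rewrite big1 ?addr0 // => c ca; rewrite mxE; case: eqP => [E|_]; last by rewrite mul0r.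
by rewrite E enum_valK eqxx in ca.
Qed.

Lemma mul_incl_trE i r (X : 'M[k]_(r, N)) a b :
  (X *m (incl i)^T) a b = X a (enum_rank (enum_val b)).
Proof. by rewrite -[X]trmxK -trmx_mul [LHS]mxE incl_mulE [RHS]mxE. Qed.

Lemma incl_incl_tr i : incl i *m (incl i)^T = 1%:M.
Proof.
apply/matrixP=> a b; rewrite incl_mulE !mxE enum_rankK (inj_eq enum_val_inj).
by rewrite eq_sym.
Qed.

Lemma incl_tr_incl i :
  (incl i)^T *m incl i = proj_on k (fun a => enum_val a \in taylor_cells i).
Proof.
apply/matrixP=> a b; rewrite projE mxE.
case sa: (enum_val a \in taylor_cells i); last first.
  rewrite andbF big1 // => c _; rewrite !mxE; case: eqP => [E|_].
    by have := enum_valP c; rewrite E sa.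
  by rewrite mul0r.
pose c := enum_rank_in sa (enum_val a).
have cE : enum_val c = enum_val a by rewrite enum_rankK_in.
rewrite (bigD1 c) //= !mxE cE eqxx mul1r (inj_eq enum_val_inj) andbT.
rewrite big1 ?addr0 // => d dc; rewrite !mxE -cE (inj_eq enum_val_inj).
by rewrite (negbTE dc) mul0r.
Qed.

Definition taylor_diff i : 'M[k]_(#|taylor_cells i.+1|, #|taylor_cells i|) :=
  incl i.+1 *m bd *m (incl i)^T.

(** Deleting an element of a cell leaves a cell, and dually a set of generators
   from which a cell results by one deletion is a cell. *)
Lemma incl_bd i : incl i.+1 *m bd = taylor_diff i *m incl i.
Proof.
rewrite /taylor_diff -mulmxA incl_tr_incl; apply/matrixP=> a b.
rewrite mul_projE incl_mulE; case: ifP => // nb.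
apply/eqP; apply: contraFT nb => /bd_neq0[x]; rewrite enum_rankK => xa ->.
have := enum_valP a; rewrite !inE => /andP[aQ /eqP ca].
rewrite (subset_trans (subD1set _ _) aQ) /=.
by move: ca; rewrite (cardsD1 x) xa add1n => -[->].
Qed.

Lemma bd_incl_tr i :
  proj_on k (fun a => (enum_val a : {set {set 'I_n}}) \subset Q) *m bd *m (incl i)^T =
  (incl i.+1)^T *m taylor_diff i.
Proof.
rewrite /taylor_diff !mulmxA incl_tr_incl; apply/matrixP=> a b.
rewrite !mul_incl_trE !proj_mulE !inE; case: ifP => //= aQ; case: ifP => // ca.
apply/eqP; apply: contraFT ca => /bd_neq0[x xa]; rewrite enum_rankK => bE.
have := enum_valP b; rewrite !inE bE => /andP[_ /eqP cb].
by rewrite (cardsD1 x) xa add1n cb.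
Qed.

Lemma incl0_bd : incl 0 *m bd = 0.
Proof.
apply/matrixP=> a b; rewrite incl_mulE mxE; apply/eqP/negPn/negP=> /bd_neq0[x].
have := enum_valP a; rewrite enum_rankK !inE cards_eq0 => /andP[_ /eqP->].
by rewrite inE.
Qed.

Lemma taylor_diff_diff i : taylor_diff i.+1 *m taylor_diff i = 0.
Proof.
rewrite {2}/taylor_diff !mulmxA -incl_bd -[_ *m bd *m bd]mulmxA bd_bd.
by rewrite mulmx0 mul0mx.
Qed.

Definition taylor_deg i (a : 'I_#|taylor_cells i|) : mon :=
  sqfree_mon (cover (enum_val a)).

Lemma taylor_diff_neq0 i a b : taylor_diff i a b != 0 ->
  exists2 F, F \in enum_val a & enum_val b = enum_val a :\ F.
Proof.
by rewrite mul_incl_trE incl_mulE => /bd_neq0[F]; rewrite !enum_rankK; exists F.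
Qed.

Lemma taylor_diff_filtered i : filtered (@taylor_deg i.+1) (@taylor_deg i) (taylor_diff i).
Proof.
apply/filteredP=> a b /taylor_diff_neq0[F Fa bE]; apply/sqfree_mon_cover=> G.
rewrite bE => /setD1P[_ Ga]; move: G Ga; apply/sqfree_mon_cover.
exact: lepm_refl.
Qed.

Definition taylor_aug : 'cV[k]_(#|taylor_cells 0|) := const_mx 1.

Lemma taylor_diff_cycle i :
  cycle_at monomial_in taylor_diff taylor_aug (@taylor_deg i.+1) (taylor_diff i).
Proof.
case: i => [|i] /=; last by rewrite taylor_diff_diff.
apply/forallP=> a; apply/orP; left.
have := enum_valP a; rewrite !inE => /andP[aQ /eqP ca].
have /set0Pn[F Fa] : enum_val a != set0 by rewrite -card_gt0 ca.
apply/existsP; exists F; rewrite (subsetP aQ _ Fa) /=.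
by move: F Fa; apply/sqfree_mon_cover; apply: lepm_refl.
Qed.

Lemma taylor_cell0 (a : 'I_#|taylor_cells 0|) : enum_val a = set0.
Proof.
by have := enum_valP a; rewrite !inE cards_eq0 => /andP[_ /eqP].
Qed.

Lemma taylor_aug_surjective u : monomial_in u \/
  exists v : 'rV_(#|taylor_cells 0|),
    filtered (fun=> u) (@taylor_deg 0) v /\ v *m taylor_aug = 1%:M.
Proof.
right; have c0 : set0 \in taylor_cells 0 by rewrite inE sub0set cards0 eqxx.
pose a := enum_rank_in c0 set0; exists (delta_mx 0 a); split.
  apply/filteredP=> b c _; rewrite /taylor_deg taylor_cell0.
  by apply/sqfree_mon_cover=> F; rewrite inE.
apply/matrixP=> b c; rewrite !ord1 -rowE !mxE; by [].
Qed.

(** In a multidegree u which some generator F divides, inserting F contracts the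
   complex; if no generator divides u, only the empty set has multidegree at most
   u. *)
Lemma taylor_exact i u (v : 'rV_(#|taylor_cells i|)) :
  filtered (fun=> u) (@taylor_deg i) v ->
  cycle_at monomial_in taylor_diff taylor_aug (fun=> u) v ->
  exists w : 'rV_(#|taylor_cells i.+1|),
    filtered (fun=> u) (@taylor_deg i.+1) w /\ w *m taylor_diff i = v.
Proof.
move=> /filteredP fv cv; have [/existsP[F /andP[FQ Fu]]|nJ] := boolP (monomial_in u).
  exists (v *m incl i *m ins k F *m (incl i.+1)^T); split.
    apply/filteredP=> a b; rewrite ord1 mul_incl_trE => /mulmx_neq0[c [vc]].
    move=> /ins_neq0[_]; rewrite enum_rankK => bE; rewrite /taylor_deg bE.
    have [d [vd]] := mulmx_neq0 vc; rewrite mxE => dc.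
    have {}dc : enum_val d = enum_val c by apply/eqP; apply: contraNT dc => /negbTE->.
    have := fv _ _ vd; rewrite /taylor_deg dc => /sqfree_mon_cover du.
    by apply/sqfree_mon_cover=> G /setU1P[->//|/du].
  have insE : incl i *m ins k F *m ((incl i.+1)^T *m incl i.+1) = incl i *m ins k F.
    rewrite incl_tr_incl; apply/matrixP=> a b; rewrite mul_projE incl_mulE.
    case: ifP => // nb; apply/esym/eqP; apply: contraFT nb => /ins_neq0[].
    rewrite enum_rankK => Fa ->; have := enum_valP a; rewrite !inE => /andP[aQ /eqP ca].
    by rewrite subUset sub1set FQ aQ cardsU1 Fa ca add1n eqxx.
  have vbd : v *m incl i *m bd = 0.
    case: i v cv {fv insE} => [|i] v /=; first by rewrite -mulmxA incl0_bd mulmx0.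
    by move=> /eqP vd; rewrite -mulmxA incl_bd mulmxA vd mul0mx.
  have {1}-> : taylor_diff i = incl i.+1 *m bd *m (incl i)^T by [].
  have -> : v *m incl i *m ins k F *m (incl i.+1)^T *m (incl i.+1 *m bd *m (incl i)^T)
      = v *m (incl i *m ins k F *m ((incl i.+1)^T *m incl i.+1)) *m bd *m (incl i)^T.
    by rewrite !mulmxA.
  have /(canRL (addKr _)) := bd_ins k F; rewrite insE => insbd.
  rewrite -[_ *m bd]mulmxA -[incl i *m _ *m bd]mulmxA insbd.
  rewrite mulmxDr mulmxN mulmx1 mulmxDr mulmxN [incl i *m _]mulmxA.
  rewrite !mulmxA vbd mul0mx oppr0 add0r -mulmxA incl_incl_tr mulmx1.
  by [].
have v0 a : v 0 a != 0 -> enum_val a = set0.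
  move=> /fv /sqfree_mon_cover da; apply/eqP; apply: contraNT nJ => /set0Pn[F Fa].
  have := enum_valP a; rewrite inE => /andP[/subsetP aQ _].
  by apply/existsP; exists F; rewrite aQ // da.
suff -> : v = 0.
  by exists 0; rewrite mul0mx; split=> //; apply/filteredP=> a b; rewrite mxE eqxx.
apply/matrixP=> z a; rewrite ord1 mxE {z}.
case: i v {fv} cv a v0 => [|i] v cv a v0; last first.
  apply/eqP/negPn/negP=> /v0 a0; have := enum_valP a.
  by rewrite a0 !inE cards0 andbF.
have /= /forallP/(_ 0) := cv; rewrite (negbTE nJ) /= mxE (bigD1 a) //= big1 => [|b ba].
  by rewrite mxE mulr1 addr0 => /eqP.
case/eqP: ba; apply: enum_val_inj; by rewrite !taylor_cell0.
Qed.

Definition taylor : filtered_resolution k monomial_in :=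
  FilteredResolution taylor_diff_filtered taylor_diff_cycle
    taylor_aug_surjective taylor_exact.

Definition cells_of_degree m : {set {set {set 'I_n}}} :=
  [set s : {set {set 'I_n}} | (s \subset Q) && (sqfree_mon (cover s) == m)].

(** The piece of multidegree m of the Taylor resolution is spanned by the cells of
   multidegree m, with the boundary truncated to them. *)
Lemma minimal_models (C : filtered_resolution k monomial_in) (m : mon) i :
  (forall j a b, fr_deg a = fr_deg b -> fr_diff C j a b = 0) ->
  models k (fun a : 'I_(fr_rank C i.+1) => fr_deg a == m) (cells_of_degree m) i.+1.
Proof.
move=> minC; set K := cells_of_degree m.
pose M j := proj_on k (fun a : 'I_(#|taylor_cells j|) => taylor_deg a == m).
have Mincl j : M j *m incl j = incl j *m chains_on k K.
  apply/matrixP=> a b; rewrite mul_projE proj_mulE mxE inE.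
  case: (eqVneq (enum_val a) (enum_val b)) => [E|]; last by rewrite !if_same.
  have := enum_valP a; rewrite inE => /andP[aQ _].
  by rewrite -E aQ.
have inclM j : (incl j)^T *m M j = chains_on k K *m (incl j)^T.
  have := congr1 trmx (Mincl j); rewrite !trmx_mul.
  by rewrite /M /chains_on /proj_on !tr_diag_mx.
have KQ : chains_on k K *m
    proj_on k (fun a => (enum_val a : {set {set 'I_n}}) \subset Q) = chains_on k K.
  rewrite /chains_on proj_proj; apply: eq_proj => a; rewrite /= inE.
  by case: (_ \subset Q); rewrite ?andbF ?andbT.
have cellsE : (incl i.+1)^T *m M i.+1 *m incl i.+1 =
    chains_on k K *m card_part k {set 'I_n} i.+1.
  rewrite inclM -mulmxA incl_tr_incl /chains_on /card_part !proj_proj.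
  by apply: eq_proj => a; rewrite /= !inE; case: (_ \subset Q).
have [f [g [h [h' [G1 G2 G3 G4]]]]] :=
  minimal_graded_equivalence monomial_in_mono taylor m i minC.
have up j := bd_on_incl (Mincl j.+1) (Mincl j) (incl_bd j).
have down j := bd_on_incl_tr (inclM j.+1) (inclM j) KQ (bd_incl_tr j).
exact: (models_transfer G1 G2 G3 G4 (up i) (up i.+1) (down i.+1) (down i)
          (Mincl _) cellsE (incl_incl_tr _) (proj_idem _ _) (proj_idem _ _)).
Qed.

End Taylor.

(** * Dehomogenization *)

Section Dehomogenization.

Variables (k : fieldType) (n : nat).
Local Open Scope ring_scope.
Notation mon := 'X_{1..n}.
Notation S := {mpoly k[n]}.

Lemma mcoeff_mulX (p : S) (m u : mon) :
  (p * 'X_[m])@_u = if (m <= u)%MM then p@_(u - m) else 0.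
Proof.
case: ifP => mu; first by rewrite -{1}(submK mu) addmC mcoeffMX.
apply/eqP; rewrite mcoeff_eq0; apply: contraFN mu => /msuppM_le/allpairsP.
case=> -[u1 u2] /= [_]; rewrite msuppX inE => /eqP-> ->.
by rewrite lem_addl.
Qed.

Lemma le0mm (u : mon) : (0 <= u)%MM.
Proof. by apply/mnm_lepP=> i; rewrite mnm0E. Qed.

Lemma lepm_sub2r (a b u : mon) : (b <= a)%MM -> (b <= u)%MM ->
  (a - b <= u - b)%MM = (a <= u)%MM.
Proof.
move=> /mnm_lepP ba /mnm_lepP bu; apply/mnm_lepP/mnm_lepP=> h i; have := h i.
  by rewrite !mnmE leq_subLR subnKC.
by rewrite !mnmE leq_subLR subnKC.
Qed.

Lemma subm_sub2r (a b u : mon) : (b <= a)%MM -> (a <= u)%MM ->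
  (u - b - (a - b) = u - a)%MM.
Proof.
move=> /mnm_lepP ba /mnm_lepP au; apply/mnmP=> i; rewrite !mnmE.
by rewrite -subnDA subnKC.
Qed.

Lemma addm_sub_sub (a b u : mon) : (b <= a)%MM -> (a <= u)%MM ->
  (u - a + (a - b) = u - b)%MM.
Proof.
move=> /mnm_lepP ba /mnm_lepP au; apply/mnmP=> i; rewrite !mnmE.
by rewrite addnBA // subnK.
Qed.

(** In a fixed multidegree u, a homogeneous row of polynomials and the row of its
   scalar coefficients determine each other. *)
Definition homogenized u s (d : 'I_s -> mon) (v : 'rV[k]_s) : 'rV[S]_s :=
  \row_b (v 0 b *: 'X_[u - d b]).

Definition coefs u s (d : 'I_s -> mon) (V : 'rV[S]_s) : 'rV[k]_s :=
  \row_b (if (d b <= u)%MM then (V 0 b)@_(u - d b) else 0).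

Lemma coefs_homogenized u s (d : 'I_s -> mon) v :
  filtered (fun=> u) d v -> coefs u d (homogenized u d v) = v.
Proof.
move=> /filteredP fv; apply/rowP=> b; rewrite !mxE mcoeffZ mcoeffX eqxx mulr1.
by case: ifP => // nb; apply/esym/eqP; apply: contraFT nb; apply: fv.
Qed.

Lemma coefs_filtered u s (d : 'I_s -> mon) V : filtered (fun=> u) d (coefs u d V).
Proof. by apply/filteredP=> a b; rewrite mxE; case: ifP => //; rewrite eqxx. Qed.

Lemma coefs0 u s (d : 'I_s -> mon) : coefs u d 0 = 0.
Proof. by apply/rowP=> b; rewrite !mxE mcoeff0 if_same. Qed.

Lemma homogenized0 u s (d : 'I_s -> mon) : homogenized u d 0 = 0.
Proof. by apply/rowP=> b; rewrite !mxE scale0r. Qed.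

Section HomogeneousMatrix.

Variables (r s : nat) (dA : 'I_r -> mon) (dB : 'I_s -> mon).
Variables (D : 'M[S]_(r, s)) (c : 'M[k]_(r, s)).
Hypothesis DE : forall a b, D a b = c a b *: 'X_[dA a - dB b].
Hypothesis fc : filtered dA dB c.

Lemma homogenized_mul u v : filtered (fun=> u) dA v ->
  homogenized u dA v *m D = homogenized u dB (v *m c).
Proof.
move=> /filteredP fv; apply/rowP=> b; rewrite !mxE scaler_suml.
apply: eq_bigr => a _; rewrite !mxE DE -scalerAl -scalerAr scalerA -mpolyXD.
have [->|va] := eqVneq (v 0 a) 0; first by rewrite !mul0r !scale0r.
have [->|ca] := eqVneq (c a b) 0; first by rewrite !mulr0 !scale0r.
by rewrite addm_sub_sub // ?(filteredP _ _ _ fc) //; apply: fv va.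
Qed.

Lemma coefs_mul u V : coefs u dB (V *m D) = coefs u dA V *m c.
Proof.
apply/rowP=> b; rewrite !mxE raddf_sum /=.
have caE a : c a b != 0 -> (dB b <= dA a)%MM by apply: (filteredP _ _ _ fc).
case: ifP => bu; last first.
  apply/esym; apply: big1 => a _; rewrite !mxE; case: ifP => au; last by rewrite mul0r.
  apply/eqP; rewrite mulf_eq0; apply/orP; right; apply: contraFT bu => /caE ba.
  exact: lepm_trans ba au.
apply: eq_bigr => a _; rewrite !mxE DE -scalerAr mcoeffZ mcoeff_mulX.
have [->|/caE ba] := eqVneq (c a b) 0; first by rewrite mul0r mulr0.
rewrite lepm_sub2r //; case: ifP => au; last by rewrite mulr0 mul0r.
by rewrite subm_sub2r // mulrC.
Qed.

End HomogeneousMatrix.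

Section FacetIdeal.

Variables (Gamma : {set {set 'I_n}}).
Local Notation J := (@monomial_in n (facets Gamma)).
Local Notation I := (@facet_ideal k n Gamma).

Lemma facet_ideal_monomial (u : mon) (c : k) : J u -> I (c *: 'X_[u]).
Proof.
move=> /existsP[F /andP[FQ Fu]].
exists (fun G => if G == F then c *: 'X_[u - sqfree_mon F] else 0).
rewrite (bigD1 F) //= eqxx big1 ?addr0 => [|G /andP[_ /negbTE->]]; last by rewrite mul0r.
by rewrite -scalerAl -mpolyXD submK.
Qed.

Lemma facet_ideal0 : I 0.
Proof. by exists (fun=> 0); rewrite big1 // => F _; rewrite mul0r. Qed.

Lemma facet_ideal_coeff (p : S) (u : mon) : I p -> ~~ J u -> p@_u = 0.
Proof.
move=> [c ->] nJ; rewrite raddf_sum big1 //= => F FQ; rewrite mcoeff_mulX.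
case: ifP => // Fu; case/negP: nJ; apply/existsP; exists F; by rewrite FQ.
Qed.

Variable F : multigraded_free_resolution I.

Definition scalar_diff i : 'M[k]_(mfr_rank F i.+1, mfr_rank F i) :=
  \matrix_(a, b) (mfr_diff F i a b)@_(mfr_deg a - mfr_deg b).

Definition scalar_aug : 'cV[k]_(mfr_rank F 0) :=
  \col_a (mfr_aug F a 0)@_(mfr_deg a).

Lemma mfr_diffE i a b :
  mfr_diff F i a b = scalar_diff i a b *: 'X_[mfr_deg a - mfr_deg b].
Proof.
apply/mpolyP=> u; rewrite mcoeffZ mcoeffX mxE.
have [<-|ne] := eqVneq; first by rewrite mulr1.
rewrite mulr0; apply/eqP; rewrite mcoeff_eq0; apply: contraNN ne.
by move=> /mfr_diff_homogeneous <-; rewrite addmK.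
Qed.

Lemma scalar_diff_filtered i :
  filtered (@mfr_deg _ _ _ F i.+1) (@mfr_deg _ _ _ F i) (scalar_diff i).
Proof.
apply/filteredP=> a b; rewrite mxE -mcoeff_msupp => /mfr_diff_homogeneous <-.
exact: lem_addl.
Qed.

Lemma mfr_augE a b : mfr_aug F a b = scalar_aug a b *: 'X_[mfr_deg a - 0].
Proof.
rewrite ord1; apply/mpolyP=> u; rewrite mcoeffZ mcoeffX mxE subm0.
have [<-|ne] := eqVneq; first by rewrite mulr1.
rewrite mulr0; apply/eqP; rewrite mcoeff_eq0; apply: contraNN ne.
by move=> /mfr_aug_homogeneous->.
Qed.

Let zero_deg (b : 'I_1) : mon := 0%MM.

Lemma scalar_aug_filtered : filtered (@mfr_deg _ _ _ F 0) zero_deg scalar_aug.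
Proof. by apply/filteredP=> a b _; apply/mnm_lepP=> i; rewrite mnm0E. Qed.

Lemma scalar_diff_cycle i : cycle_at J scalar_diff scalar_aug
  (@mfr_deg _ _ _ F i.+1) (scalar_diff i).
Proof.
have coefs_row j (a : 'I_(mfr_rank F j.+1)) :
    coefs (mfr_deg a) (@mfr_deg _ _ _ F j) (row a (mfr_diff F j)) = row a (scalar_diff j).
  apply/rowP=> b; rewrite !mxE; case: ifP => // nb; apply/esym/eqP.
  apply: contraFT nb; rewrite -mcoeff_msupp => /mfr_diff_homogeneous <-.
  exact: lem_addl.
case: i => [|i] /=.
  apply/forallP=> a; have [//|nJ] := boolP (J (mfr_deg a)); apply/eqP.
  have /(mfr_exact0 (m := F)) ia : exists w, row a (mfr_diff F 0) = w *m mfr_diff F 0.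
    by exists (delta_mx 0 a); rewrite -rowE.
  have <- : (row a (scalar_diff 0) *m scalar_aug) 0 0 = (scalar_diff 0 *m scalar_aug) a 0.
    by rewrite -row_mul mxE.
  rewrite -coefs_row -(coefs_mul mfr_augE scalar_aug_filtered) mxE le0mm subm0.
  exact: facet_ideal_coeff ia nJ.
apply/eqP/row_matrixP=> a; rewrite row_mul row0 -coefs_row.
rewrite -(coefs_mul (@mfr_diffE i) (scalar_diff_filtered i)).
have /(mfr_exactS (m := F)) -> : exists w, row a (mfr_diff F i.+1) = w *m mfr_diff F i.+1.
  by exists (delta_mx 0 a); rewrite -rowE.
exact: coefs0.
Qed.

Lemma scalar_aug_surjective u : J u \/
  exists v : 'rV_(mfr_rank F 0),
    filtered (fun=> u) (@mfr_deg _ _ _ F 0) v /\ v *m scalar_aug = 1%:M.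
Proof.
have [Ju|nJ] := boolP (J u); [by left | right].
have [V IV] := mfr_aug_surjective F 'X_[u].
exists (coefs u (@mfr_deg _ _ _ F 0) V); split; first exact: coefs_filtered.
rewrite -(coefs_mul mfr_augE scalar_aug_filtered); apply/rowP=> b; rewrite ord1.
rewrite [LHS]mxE [RHS]mxE le0mm subm0.
have /eqP := facet_ideal_coeff IV nJ.
by rewrite mcoeffB mcoeffX eqxx subr_eq0 => /eqP<-.
Qed.

Lemma scalar_diff_exact i u (v : 'rV_(mfr_rank F i)) :
  filtered (fun=> u) (@mfr_deg _ _ _ F i) v ->
  cycle_at J scalar_diff scalar_aug (fun=> u) v ->
  exists w : 'rV_(mfr_rank F i.+1),
    filtered (fun=> u) (@mfr_deg _ _ _ F i.+1) w /\ w *m scalar_diff i = v.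
Proof.
move=> fv cv.
suff [W WE] : exists W, homogenized u (@mfr_deg _ _ _ F i) v = W *m mfr_diff F i.
  exists (coefs u (@mfr_deg _ _ _ F i.+1) W); split; first exact: coefs_filtered.
  by rewrite -(coefs_mul (@mfr_diffE i) (scalar_diff_filtered i)) -WE coefs_homogenized.
case: i v fv cv => [|i] v fv /= cv; last first.
  apply/mfr_exactS; rewrite (homogenized_mul (@mfr_diffE i) (scalar_diff_filtered i)) //.
  by rewrite (eqP cv) homogenized0.
apply/mfr_exact0; rewrite (homogenized_mul mfr_augE scalar_aug_filtered) // mxE subm0.
case/orP: (forallP cv 0) => [|/eqP->]; first exact: facet_ideal_monomial.
by rewrite scale0r; apply: facet_ideal0.
Qed.

(** All variables are set to 1, the multidegrees being kept as a filtration. *)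
Definition dehomogenization : filtered_resolution k J :=
  FilteredResolution scalar_diff_filtered scalar_diff_cycle
    scalar_aug_surjective scalar_diff_exact.

Lemma betti_models m i : minimal_resolution F ->
  exists2 P : pred 'I_(mfr_rank F i.+1), betti F i.+1 m = #|P| &
    models k P (cells_of_degree (facets Gamma) m) i.+1.
Proof.
move=> minF; exists (fun a => mfr_deg a == m).
  by apply: eq_card => a; rewrite inE.
apply: (@minimal_models _ _ _ dehomogenization) => j a b /= ab.
rewrite mxE ab; have -> : (mfr_deg b - mfr_deg b = 0)%MM.
  by apply/mnmP=> v; rewrite !mnmE subnn.
exact: minF.
Qed.

End FacetIdeal.

End Dehomogenization.

(** * Betti numbers of simplicial forests *)

Section BettiForest.

Variables (k : fieldType) (n : nat) (Gamma : {set {set 'I_n}}).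
Implicit Types (A F : {set 'I_n}) (m : 'X_{1..n}).

Lemma mvars_sqfree A : mvars (sqfree_mon A) = A.
Proof. by apply/setP=> v; rewrite inE mnmE lt0b. Qed.

Lemma mdeg_sqfree A : mdeg (sqfree_mon A) = #|A|.
Proof.
rewrite mdegE -sum1_card [RHS]big_mkcond /=; apply: eq_bigr => v _.
by rewrite mnmE; case: (v \in A).
Qed.

Lemma vertices_induced A :
  vertices (induced_subcollection Gamma A) = cover [set F in facets Gamma | F \subset A].
Proof. exact: vertices_generated. Qed.

Lemma vertices_induced_sub A : vertices (induced_subcollection Gamma A) \subset A.
Proof. by rewrite vertices_induced; apply/cover_subP=> F; rewrite inE => /andP[]. Qed.

Lemma induced_vertices A :
  induced_subcollection Gamma (vertices (induced_subcollection Gamma A)) =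
  induced_subcollection Gamma A.
Proof.
rewrite {1 3}/induced_subcollection; congr generated_complex; apply/setP=> F.
apply/setIdP/setIdP=> -[FQ FA]; split=> //.
  exact: subset_trans FA (vertices_induced_sub A).
by rewrite vertices_induced; apply: sub_cover; apply/setIdP.
Qed.

(** The monomial m is the least common multiple of the generators dividing it. *)
Definition betti_multidegree m : bool :=
  m == sqfree_mon (vertices (induced_subcollection Gamma (mvars m))).

Lemma cells_of_degree_covers m : betti_multidegree m ->
  let Q := [set F in facets Gamma | F \subset mvars m] in
  cells_of_degree (facets Gamma) m = covers set0 Q (cover Q).
Proof.
rewrite /betti_multidegree vertices_induced; set Q := [set _ in _ | _] => /eqP mE /=.
have QG : Q \subset facets Gamma by apply/subsetP=> F; rewrite inE => /andP[].
have varsE : mvars m = cover Q by rewrite {1}mE mvars_sqfree.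
apply/setP=> s; rewrite !inE sub0set set0U /=.
apply/andP/andP=> [[sG /eqP sm]|[sQ Qs]].
  have sQ : cover s = cover Q by rewrite -varsE -sm mvars_sqfree.
  rewrite sQ subxx; split=> //; apply/subsetP=> F Fs.
  by rewrite inE (subsetP sG) //= varsE -sQ sub_cover.
split; first exact: subset_trans sQ QG.
rewrite [X in _ == X]mE; apply/eqP; congr sqfree_mon.
by apply/eqP; rewrite eqEsubset Qs coverS.
Qed.

Lemma cells_of_degree0 m : ~~ betti_multidegree m ->
  cells_of_degree (facets Gamma) m = set0.
Proof.
move=> nm; apply/setP=> s; rewrite !inE; apply: contraNF nm => /andP[sG /eqP sm].
have varsE : mvars m = cover s by rewrite -sm mvars_sqfree.
rewrite /betti_multidegree -{1}sm vertices_induced varsE; apply/eqP; congr sqfree_mon.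
apply/eqP; rewrite eqEsubset; apply/andP; split; apply/cover_subP=> F.
  by move=> Fs; apply: sub_cover; rewrite inE (subsetP sG) // sub_cover.
by rewrite inE => /andP[].
Qed.

Hypothesis forestG : simplicial_forest Gamma.
Variable F : multigraded_free_resolution (@facet_ideal k n Gamma).
Hypothesis minF : minimal_resolution F.

(** The covers of the induced subcollection collapse to nothing or to a single
   well ordered cover, which gives the Betti numbers.  Conversely any well ordered
   cover is isolated after some collapses, hence contributes to the homology. *)
Lemma betti_forest m i :
  betti F i.+1 m = (betti_multidegree m &&
    has_well_ordered_facet_cover (induced_subcollection Gamma (mvars m)) i.+1).
Proof.
have [P -> mP] := betti_models m i minF.
have [mE|nmE] /= := boolP (betti_multidegree m); last first.
  by move: mP; rewrite cells_of_degree0 //; apply: models_set0.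
move: mP; rewrite cells_of_degree_covers //; set Q := [set _ in _ | _] => mP.
have QG : Q \subset facets Gamma by apply/subsetP=> G; rewrite inE => /andP[].
have lQ : leafy Q := leafyS QG (forest_leafy forestG).
have aQ : antichain Q := antichainS QG (@facets_antichain _ _).
have cvx := @covers_convex _ set0 Q (cover Q).
have size_cover t : well_ordered_facet_cover (generated_complex Q) t ->
    #|[set:: t]| = size t.
  by case/and3P=> ut _ _; rewrite cardsE; apply/card_uniqP.
have wo_nz : has_well_ordered_facet_cover (induced_subcollection Gamma (mvars m)) i.+1 ->
    #|P| <> 0.
  case/existsP=> t wt; have [L KL [tL below above]] := well_ordered_isolated aQ wt.
  apply: (models_isolated (s := [set:: t]) tL _ _ _ (models_collapses cvx KL mP)).
  + by rewrite size_cover // size_tuple.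
  + by move=> x; rewrite inE; apply: below.
  + by move=> x; rewrite inE; apply: above.
have [K0|[t wt Kt]] := covers_collapse_well_ordered lQ aQ.
  have P0 := models_set0 (models_collapses cvx K0 mP); rewrite P0.
  by case: has_well_ordered_facet_cover wo_nz => // /(_ isT).
have PE := models_set1 (models_collapses cvx Kt mP); rewrite PE; congr nat_of_bool.
apply/eqP/idP => [ct|/wo_nz]; last by rewrite PE; case: eqP.
have st : size t == i.+1 by rewrite -ct size_cover.
by apply/existsP; exists (Tuple st).
Qed.

End BettiForest.

Theorem theorem3p7 (k : fieldType) (n : nat) (Gamma : {set {set 'I_n}})
    (complexG : simplicial_complex Gamma)
    (verticesG : vertices Gamma = [set: 'I_n])
    (forestG : simplicial_forest Gamma)
    (F : multigraded_free_resolution (@facet_ideal k n Gamma))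
    (minF : minimal_resolution F)
    (i : nat) (i_ge1 : 1 <= i) :
  (forall m : 'X_{1..n},
     [<-> betti F i m <> 0;
          betti F i m = 1;
          m = sqfree_mon (vertices (induced_subcollection Gamma (mvars m))) /\
          has_well_ordered_facet_cover
            (induced_subcollection Gamma (mvars m)) i])
  /\
  (forall j : nat,
     graded_betti F i j =
     #|[set Delta in [set induced_subcollection Gamma A | A : {set 'I_n}] |
          (#|vertices Delta| == j) && has_well_ordered_facet_cover Delta i]|).
Proof.
case: i i_ge1 => // i _; split=> [m|j].
  rewrite betti_forest //; split; first by case: (_ && _).
  split; first by case: andP => // -[/eqP].
  by case=> /eqP; rewrite -/(betti_multidegree _ m) => -> ->.
pose M := [set m : 'X_{1..n < j.+1} | (mdeg m == j) && (betti_multidegree Gamma m &&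
    has_well_ordered_facet_cover (induced_subcollection Gamma (mvars m)) i.+1)].
have -> : graded_betti F i.+1 j = #|M|.
  rewrite /graded_betti -sum1_card big_mkcond [RHS]big_mkcond /=.
  apply: eq_bigr => m _; rewrite inE betti_forest //.
  by case: (mdeg m == j); case: (betti_multidegree _ _); case: has_well_ordered_facet_cover.
(* The multidegree is recovered from the subcollection as its vertex set. *)
pose g (m : 'X_{1..n < j.+1}) := induced_subcollection Gamma (mvars m).
have inj_g : {in M &, injective g}.
  move=> m1 m2; rewrite !inE => /and3P[_ /eqP E1 _] /and3P[_ /eqP E2 _] g12.
  apply: val_inj => /=; rewrite E1 E2; congr (sqfree_mon (vertices _)); exact: g12.
rewrite -(card_in_imset inj_g); apply: eq_card => Delta; rewrite [RHS]inE.
apply/imsetP/and3P=> [[m]|[/imsetP[A _ ->{Delta}]]].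
  rewrite inE => /and3P[/eqP mj /eqP mE wm] ->; split=> //.
    by apply/imsetP; exists (mvars m).
  by rewrite -(mdeg_sqfree (vertices (g m))) -mE mj.
set V := vertices _ => /eqP Vj wo.
have mj : mdeg (sqfree_mon V) < j.+1 by rewrite mdeg_sqfree Vj.
exists (BMultinom mj); last by rewrite /g mvars_sqfree induced_vertices.
rewrite inE /= mdeg_sqfree Vj eqxx /betti_multidegree mvars_sqfree induced_vertices.
by rewrite eqxx.
Qed.
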